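(* Let $k,n\in\mathbb N$ with $1\le k<n$ and $\lambda\vdash n$. Then $$(n-k)\,\varepsilon_\lambda(k)=(n-1)!\sum_{x\in\lambda}h'(x)+\sum_{l=1}^{k-1}\varepsilon_\lambda(l)-\frac{n!}{f_\lambda}\sum_{x\in\lambda}h'(x)\,f_\lambda(k,x),$$ and $$\varepsilon_\lambda(k)=\frac{n!}{(n-k)(n-k+1)}\sum_{x\in\lambda}h'(x)\left(1-\frac{f_\lambda(k,x)}{f_\lambda}(n-k+1)-\sum_{l=1}^{k-1}\frac{f_\lambda(l,x)}{f_\lambda}\right).$$
   Context: A partition $\lambda\vdash n$ is identified with its Young diagram $\{(i,j): i\ge1,\ 1\le j\le\lambda_i\}$. For $x=(i,j)$, the cohook length is $h'(x)=i+j-2$. A tabloid is a bijection $T:\lambda\to\{1,\dots,n\}$; $\operatorname{T}(\lambda)$ is the set of tabloids. A standard Young tableau is a tabloid with entries increasing along rows and down columns; $f_\lambda$ is their number and $f_\lambda(k,x)$ the number with entry $k$ in cell $x$. Order cells by $(i,j)\prec(k,l)$ iff $j<l$, or $j=l$ and $i<k$; list them $z_1\prec\dots\prec z_n$. Novelli--Pak--Stoyanovskii sorting of $T$: $T_{z_n}:=T$; for $m=n-1,\dots,1$, $T_{z_m}=\sigma_{z_m}\circ T_{z_{m+1}}$, where the slide $\sigma_{z_m}$ repeatedly exchanges the entry in $z_m$ with the smaller of the entries in its current right and bottom neighbours as long as that entry is smaller than it. Exchange numbers: for $1\le k<n$, $\varepsilon_\lambda(k)$ is the number of $T\in\operatorname{T}(\lambda)$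 such that, with $z$ the cell with $T(z)=n$, the slide $\sigma_z$ moves the entry $k$ (i.e. $\sigma_z(k)\neq k$). *)

(* Defs.v *)
From mathcomp Require Import all_boot all_order all_algebra.
Set Implicit Arguments. Unset Strict Implicit. Unset Printing Implicit Defensive.

Definition is_partition (lam : seq nat) : bool :=
  sorted geq lam && all (fun p => 0 < p) lam.

Definition in_diagram (lam : seq nat) (c : nat * nat) : bool :=
  (1 <= c.1) && (1 <= c.2) && (c.2 <= nth 0 lam c.1.-1).

(* The cells of lam listed in the order z_1 < ... < z_n, where
   (i,j) < (k,l) iff j < l, or j = l and i < k (column by column). *)
Definition cells (lam : seq nat) : seq (nat * nat) :=
  [seq c <- [seq (i, j) | j <- iota 1 (head 0 lam), i <- iota 1 (size lam)]
     | in_diagram lam c].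

Definition cohook (c : nat * nat) : nat := c.1 + c.2 - 2.

(* Tabloids: a bijection T : lam -> {1..n} is encoded by the sequence
   t of its values on z_1, ..., z_n; the tabloids are exactly the
   permutations of [1; ...; n]. *)
Definition tabloids (lam : seq nat) : seq (seq nat) :=
  permutations (iota 1 (sumn lam)).

Definition fill (lam : seq nat) (t : seq nat) (c : nat * nat) : nat :=
  nth 0 t (index c (cells lam)).

Definition standard (lam : seq nat) (F : nat * nat -> nat) : bool :=
  all (fun c =>
         (in_diagram lam (c.1, c.2.+1) ==> (F c < F (c.1, c.2.+1))) &&
         (in_diagram lam (c.1.+1, c.2) ==> (F c < F (c.1.+1, c.2))))
      (cells lam).

Definition f_lam (lam : seq nat) : nat :=
  count (fun t => standard lam (fill lam t)) (tabloids lam).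

Definition f_lam_at (lam : seq nat) (k : nat) (x : nat * nat) : nat :=
  count (fun t => standard lam (fill lam t) && (fill lam t x == k))
        (tabloids lam).

Definition swapF (F : nat * nat -> nat) (p q : nat * nat) : nat * nat -> nat :=
  fun c => if c == p then F q else if c == q then F p else F c.

(* The slide sigma_p: repeatedly exchange the moving entry (currently in p)
   with the smaller of the entries of its right and bottom neighbours (those
   inside lam) as long as that entry is smaller.  Each step increases i + j,
   so [size (cells lam)] steps of fuel suffice. *)
Fixpoint slide_aux (fuel : nat) (lam : seq nat) (F : nat * nat -> nat)
    (p : nat * nat) : nat * nat -> nat :=
  match fuel with
  | 0 => F
  | fuel'.+1 =>
    let r := (p.1, p.2.+1) in
    let b := (p.1.+1, p.2) in
    let oq :=
      if in_diagram lam r then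
        (if in_diagram lam b then (if F b < F r then Some b else Some r)
         else Some r)
      else (if in_diagram lam b then Some b else None) in
    match oq with
    | Some q => if F q < F p then slide_aux fuel' lam (swapF F p q) q else F
    | None => F
    end
  end.

Definition slide (lam : seq nat) (F : nat * nat -> nat) (p : nat * nat)
  : nat * nat -> nat := slide_aux (size (cells lam)) lam F p.

(* NPS sorting stage: T_z, i.e. T_{z_n} := T and T_{z_m} := sigma_{z_m} T_{z_{m+1}},
   stopping at T_{z^+} just before sigma_z is applied
   (the slides at z_{n-1}, ..., z_{m+1} when z = z_m). *)
Definition nps_before (lam : seq nat) (F : nat * nat -> nat) (z : nat * nat)
  : nat * nat -> nat :=
  let cs := cells lam in
  foldr (fun c G => slide lam G c) F
        (drop (index z cs).+1 (take (size cs).-1 cs)).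

Definition slide_moves (lam : seq nat) (G : nat * nat -> nat) (z : nat * nat)
    (k : nat) : bool :=
  has (fun c => (G c == k) && (slide lam G z c != k)) (cells lam).

Definition exch (lam : seq nat) (k : nat) : nat :=
  count (fun t =>
           let z := nth (0, 0) (cells lam) (index (sumn lam) t) in
           slide_moves lam (nps_before lam (fill lam t) z) z k)
        (tabloids lam).

(* Main.v *)
Require Import Defs.
From mathcomp Require Import all_boot all_order all_algebra.
From mathcomp Require Import zify ring lra.
From Stdlib Require Import FunctionalExtensionality.
Import GRing.Theory Num.Theory.

(** Idea. During a slide started at z, every displaced entry moves one step up
or left, which lowers the cohook of its cell by one, and the moving entry gains
what the displaced entries lose. Summing the cohook of the cell of k over all
slides and all tabloids, k loses one for every slide of a larger entry that
displaces it and gains one for every smaller entry it displaces. Whether a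
slide of l > k displaces k does not depend on the size of l: relabelling
cyclically so that l becomes n only prolongs the path of the slide through
entries above l. Hence
   (n - k) eps(k) + final = initial + sum_(l < k) eps(l),
where initial = (n-1)! sum h' and final = K sum h'(x) f(k,x), provided that
every standard tableau is the outcome of the same number K = n!/f of tabloids.

For this uniformity, consider the stage at which the cells z' >= (i,j) are
sorted. From a cell c of the sorted part walk backwards, always to the larger
of the left and upper neighbours; a slide from (i,j) ending in c can be undone
iff this walk reaches (i,j). If L is the length of column j and r_h the number
of cells in row h whose walk reaches (i,j), the number of tabloids leading to a
given sorted filling is a constant times prod_(i <= h <= L) (L - h + r_h). Two
backward walks that meet coincide from there on, so the walks are linearly
ordered from south-west to north-east; undoing the slide along the walk of c
turns r_(h+1) into one plus the number of reaching cells of row h below c in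
this order when h is smaller than the row of c, and r_h into the number of such
cells when h is larger. So the recursion for the product is a telescoping sum over
the reaching cells. For i = 1 all walks reach (1,j), and the product does not
depend on the filling. *)

(** * A telescoping product over a linearly ordered set *)

(** Deleting the [lt]-largest element c of s lowers only the factor of index [row c], and by one.
    The product therefore drops by the product of the other factors, which is the summand of c
    because all remaining elements lie below c. The induction lists s in decreasing order. *)
Lemma prod_telescope (T : eqType) (row : T -> nat) (lt : rel T) (N : nat -> nat)
    (a b : nat) (s : seq T) :
    uniq s -> irreflexive lt -> transitive lt ->
    {in s &, forall x y, [|| x == y, lt x y | lt y x]} ->
    {in s, forall c, a <= row c < b} ->
  \prod_(a <= h < b) (N h + count (fun d => row d == h) s) =
  \prod_(a <= h < b) N h +
  \sum_(c <- s) \prod_(a <= h < b | h != row c)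
     (N h + count (fun d => (row d == h) && lt d c) s).
Proof.
move=> us irr tr tot rng.
pose le x y := (x == y) || lt y x.
have le_tr : transitive le.
  move=> y x z /orP[/eqP->//|xy] /orP[/eqP<-|yz]; apply/orP; right=> //.
  exact: tr yz xy.
have [s' us' ps'] : exists2 s', uniq s' & perm_eq s' s /\ sorted le s'.
  exists (sort le s); first by rewrite sort_uniq.
  split; first by rewrite perm_sort.
  apply: (@sort_sorted_in _ (mem s)); last exact/allP.
  move=> x y xs ys; have := tot x y xs ys; rewrite /le (eq_sym y x).
  by case/or3P=> ->; rewrite ?orbT.
case: ps' => ps' srt.
have cntE P : count P s = count P s' by apply/permP; rewrite perm_sym.
under eq_bigr do rewrite cntE.
rewrite -(perm_big _ ps') /=.
under [X in _ = _ + X]eq_bigr do under eq_bigr do rewrite cntE.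
have {}rng : {in s', forall c, a <= row c < b}.
  by move=> c; rewrite (perm_mem ps'); apply: rng.
move: {tot cntE ps' us} us' srt rng; elim: s' => [|c s' IH] /=.
  move=> _ _ _; rewrite big_nil addn0.
  by apply: eq_bigr => h _; rewrite addn0.
case/andP=> cs' us'; rewrite path_sortedE // => /andP[/allP cmax srt] rng.
have clt d : d \in s' -> lt d c.
  move=> ds; have := cmax d ds; rewrite /le => /orP[/eqP E|//].
  by rewrite E ds in cs'.
have /andP[arc rcb] : a <= row c < b by apply: rng; rewrite inE eqxx.
have mrc : row c \in index_iota a b by rewrite mem_index_iota arc.
rewrite big_cons addnCA.
have -> : \sum_(j <- s') \prod_(a <= i < b | i != row j)
     (N i + ((row c == i) && lt c j + count (fun d => (row d == i) && lt d j) s'))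
   = \sum_(j <- s') \prod_(a <= i < b | i != row j)
     (N i + count (fun d => (row d == i) && lt d j) s').
  rewrite [LHS]big_seq [RHS]big_seq; apply: eq_bigr => d ds.
  apply: eq_bigr => h _; congr (_ + _).
  case E: (lt c d); last by rewrite andbF.
  by have := tr _ _ _ E (clt d ds); rewrite irr.
rewrite -IH //; last by move=> d ds; apply: rng; rewrite inE ds orbT.
have pick G : \prod_(a <= h < b) G h =
    G (row c) * \prod_(a <= h < b | h != row c) G h :> nat.
  by rewrite (bigD1_seq (row c)) //= iota_uniq.
rewrite !pick eqxx.
have -> : \prod_(a <= i < b | i != row c)
     (N i + ((row c == i) && lt c c + count (fun d => (row d == i) && lt d c) s'))
   = \prod_(a <= i < b | i != row c) (N i + count (fun d => row d == i) s').
  apply: eq_bigr => h _; rewrite irr andbF add0n; congr (_ + _).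
  by apply: eq_in_count => d ds /=; rewrite clt ?andbT.
have -> : \prod_(a <= i < b | i != row c)
     (N i + ((row c == i) + count (fun d => row d == i) s'))
   = \prod_(a <= i < b | i != row c) (N i + count (fun d => row d == i) s').
  by apply: eq_bigr => h /negPf; rewrite eq_sym => ->.
by rewrite addnCA mulnDl mul1n.
Qed.

(** * Backward walks *)

Section ReversePath.

Variables (F : nat * nat -> nat) (j : nat).

(* The backward walk in the columns >= j goes up from (r, x) if this holds, and
   left otherwise; it leaves row r in column [exit_col r x] if it visits (r, x),
   and the walk of c comes into row r <= c.1 in column [enter_col c r]. *)
Definition goes_up (r x : nat) : bool :=
  (x <= j) || ((1 < r) && (F (r, x.-1) < F (r.-1, x))).

Fixpoint exit_col (r x : nat) : nat :=
  if x is x'.+1 then (if goes_up r x then x else exit_col r x') else 0.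

Fixpoint enter_col_rec (h y d : nat) : nat :=
  if d is d'.+1 then exit_col (h - d') (enter_col_rec h y d') else y.

Definition enter_col (c : nat * nat) (r : nat) : nat :=
  enter_col_rec c.1 c.2 (c.1 - r).

Definition reaches (i : nat) (c : nat * nat) : bool :=
  exit_col i (enter_col c i) == j.

(* The walk of d lies south-west of that of c. *)
Definition path_lt (d c : nat * nat) : bool :=
  if d.1 < c.1 then d.2 < enter_col c d.1
  else if d.1 == c.1 then d.2 < c.2 else enter_col d c.1 <= c.2.

Lemma exit_col_le r x : exit_col r x <= x.
Proof. by elim: x => //= x IH; case: ifP => // _; lia. Qed.

Lemma goes_up_exit r x : goes_up r (exit_col r x).
Proof. by elim: x => //= x IH; case: ifP. Qed.

(** With [exit_col_le] and [goes_up_exit] this describes [exit_col r x] as the last column up to x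
    in which the walk may turn up. Comparisons of walks rest on this maximality. *)
Lemma exit_col_max r x y : y <= x -> goes_up r y -> y <= exit_col r x.
Proof.
elim: x => [|x IH] /=; first by case: y.
rewrite leq_eqVlt => /orP[/eqP->->//|yx uy].
by case: ifP => _; [exact: ltnW | exact: IH].
Qed.

Lemma exit_col_mono r x y : x <= y -> exit_col r x <= exit_col r y.
Proof.
move=> xy; apply: exit_col_max (goes_up_exit r x).
exact: leq_trans (exit_col_le r x) xy.
Qed.

Lemma exit_col_ge r x : j <= x -> j <= exit_col r x.
Proof. by move=> jx; apply: exit_col_max => //; rewrite /goes_up leqnn. Qed.

Lemma enter_col_start c : enter_col c c.1 = c.2.
Proof. by rewrite /enter_col subnn. Qed.

Lemma enter_colS c r : r < c.1 -> enter_col c r = exit_col r.+1 (enter_col c r.+1).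
Proof.
move=> rc; rewrite /enter_col.
have -> : c.1 - r = (c.1 - r.+1).+1 by lia.
by rewrite /=; congr (exit_col _ _); lia.
Qed.

(** Walks may merge but never cross: [exit_col] is monotone, so a weak order of two walks in one row
    persists in all higher rows. *)
Lemma enter_col_mono c d r r' : r' <= r -> r <= c.1 -> r <= d.1 ->
  enter_col c r <= enter_col d r -> enter_col c r' <= enter_col d r'.
Proof.
move=> r'r rc rd le_r; rewrite -(subKn r'r); move: (r - r') => k.
elim: k => [|k IH]; first by rewrite subn0.
case: (ltnP k r) => kr; last by have -> : r - k.+1 = r - k by lia.
have E : r - k = (r - k.+1).+1 by lia.
rewrite (@enter_colS c); last by lia.
rewrite (@enter_colS d); last by lia.
by rewrite -E; apply: exit_col_mono.
Qed.

Lemma enter_col_ge c r : j <= c.2 -> j <= enter_col c r.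
Proof.
rewrite /enter_col; elim: (c.1 - r) => //= k IH jc.
by apply: exit_col_ge; apply: IH.
Qed.

Lemma enter_col_le c r : enter_col c r <= c.2.
Proof.
rewrite /enter_col; elim: (c.1 - r) => //= k IH.
exact: leq_trans (exit_col_le _ _) IH.
Qed.

Lemma path_lt_irr : irreflexive path_lt.
Proof. by move=> c; rewrite /path_lt ltnn eqxx ltnn. Qed.

Lemma path_lt_total c d : [|| c == d, path_lt c d | path_lt d c].
Proof.
rewrite /path_lt (eq_sym d.1); case: c d => [r x] [r' x'] /=; rewrite xpair_eqE.
by case: (ltngtP r r') => /= _; lia.
Qed.

Lemma path_lt_enter d c r : r <= d.1 -> r <= c.1 -> path_lt d c ->
  enter_col d r <= enter_col c r.
Proof.
move=> rd rc; rewrite /path_lt; case: (ltngtP d.1 c.1) => E lt.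
- by apply: (@enter_col_mono _ _ d.1) => //; [lia | rewrite enter_col_start; lia].
- by apply: (@enter_col_mono _ _ c.1) => //; [lia | rewrite enter_col_start].
- apply: (@enter_col_mono _ _ d.1) => //; first by rewrite E.
  by rewrite [X in _ <= enter_col _ X]E !enter_col_start ltnW.
Qed.

Lemma path_lt_strict d c : d.1 <= c.1 -> path_lt d c ->
  enter_col d d.1 < enter_col c d.1.
Proof.
rewrite enter_col_start /path_lt; case: (ltngtP d.1 c.1) => // E _.
by rewrite E enter_col_start.
Qed.

Lemma path_lt_asym d c : path_lt d c -> path_lt c d = false.
Proof.
rewrite /path_lt (eq_sym c.1); case: (ltngtP d.1 c.1) => /= _; lia.
Qed.

(** By totality a failure would give a cycle of three cells. In the row of the topmost of them all
    three walks are present and weakly ordered around the cycle, with one inequality strict by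
    [path_lt_strict]. *)
Lemma path_lt_trans : transitive path_lt.
Proof.
move=> b a c ab bc.
case ac: (path_lt a c) => //; have := path_lt_total a c; rewrite ac /=.
case/orP => [/eqP E|ca].
  by rewrite E in ab; rewrite (path_lt_asym _ _ ab) in bc.
have cycle x y z : path_lt x y -> path_lt y z -> path_lt z x ->
    x.1 <= y.1 -> x.1 <= z.1 -> False.
  move=> xy yz zx ley lez.
  have := path_lt_strict _ _ ley xy.
  have := path_lt_enter _ _ _ ley lez yz.
  have := path_lt_enter _ _ _ lez (leqnn _) zx.
  lia.
case: (leqP a.1 b.1) => lab; case: (leqP b.1 c.1) => lbc; case: (leqP c.1 a.1) => lca.
all: try (by case: (cycle a b c); lia).
all: try (by case: (cycle b c a); lia).
all: by case: (cycle c a b); lia.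
Qed.

End ReversePath.

(** * Undoing a slide *)

Lemma swapFl F p q : swapF F p q p = F q.
Proof. by rewrite /swapF eqxx. Qed.

Lemma swapFr F p q : swapF F p q q = F p.
Proof. by rewrite /swapF eqxx; case: eqP => // ->. Qed.

Lemma swapFo F p q c : c != p -> c != q -> swapF F p q c = F c.
Proof. by rewrite /swapF => /negPf-> /negPf->. Qed.

Lemma swapFK F p q : swapF (swapF F p q) q p = F.
Proof.
apply: functional_extensionality => c.
have [->|cq] := eqVneq c q; first by rewrite swapFl swapFl.
have [->|cp] := eqVneq c p; first by rewrite !swapFr.
by rewrite !swapFo.
Qed.

(** Makes [swapF] a precomposition with an involution of the cells, which gives injectivity and the
    multiset of values at once. *)
Definition exchange_cells (p q c : nat * nat) : nat * nat :=
  if c == p then q else if c == q then p else c.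

Lemma swapFE F p q c : swapF F p q c = F (exchange_cells p q c).
Proof. by rewrite /swapF /exchange_cells; case: ifP => //; case: ifP. Qed.

Lemma exchange_cellsK p q : involutive (exchange_cells p q).
Proof.
move=> c; rewrite /exchange_cells.
case: (eqVneq c p) => [->|cp].
  by case: (eqVneq q p) => [->|_] //; rewrite eqxx.
case: (eqVneq c q) => [->|cq]; first by rewrite eqxx.
by rewrite (negPf cp) (negPf cq).
Qed.

Lemma exchange_cells_in (A : {pred nat * nat}) p q c :
  p \in A -> q \in A -> c \in A -> exchange_cells p q c \in A.
Proof. by rewrite /exchange_cells; case: ifP => //; case: ifP. Qed.

Lemma swapF_inj (A : {pred nat * nat}) F p q : p \in A -> q \in A ->
  {in A &, injective F} -> {in A &, injective (swapF F p q)}.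
Proof.
move=> Ap Aq injF c d Ac Ad; rewrite !swapFE => E.
apply: (inv_inj (exchange_cellsK p q)).
by apply: injF E; apply: exchange_cells_in.
Qed.

Lemma perm_map_swapF (s : seq (nat * nat)) F p q : uniq s -> p \in s -> q \in s ->
  perm_eq (map (swapF F p q) s) (map F s).
Proof.
move=> us ps qs.
rewrite (eq_map (swapFE F p q)) (map_comp F); apply: perm_map.
have inj := inv_inj (exchange_cellsK p q).
apply: uniq_perm => //; first by rewrite map_inj_uniq.
move=> c; rewrite -[in LHS](exchange_cellsK p q c) mem_map //.
apply/idP/idP => H; last exact: (exchange_cells_in (mem s)).
by rewrite -(exchange_cellsK p q c); apply: (exchange_cells_in (mem s)).
Qed.

Section Diagram.

Variable lam : seq nat.
Hypothesis lam_part : is_partition lam.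

Local Notation D := (in_diagram lam).

Lemma nth_part_anti r r' : r <= r' -> nth 0 lam r' <= nth 0 lam r.
Proof.
move=> rr'; case/andP: lam_part => srt _.
case: (ltnP r' (size lam)) => r's; last by rewrite nth_default.
have tr : transitive geq by move=> a b c /= ab bc; exact: leq_trans bc ab.
apply: (sorted_leq_nth tr _ 0 srt) => //; last by rewrite inE; lia.
by move=> a /=.
Qed.

Lemma diagram_down r x r' x' : D (r, x) -> 1 <= r' <= r -> 1 <= x' <= x -> D (r', x').
Proof.
rewrite /in_diagram /= => /andP[/andP[r1 x1] xl] /andP[-> rr'] /andP[-> xx'] /=.
apply: leq_trans xx' (leq_trans xl _); apply: nth_part_anti; lia.
Qed.

Lemma diagram_pos r x : D (r, x) -> (1 <= r) && (1 <= x).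
Proof. by rewrite /in_diagram /= => /andP[]. Qed.

Lemma diagram_head r x : D (r, x) -> x <= head 0 lam.
Proof.
have := nth_part_anti 0 r.-1 (leq0n _); rewrite nth0.
by rewrite /in_diagram /=; clear; lia.
Qed.

Definition child (c d : nat * nat) : bool :=
  D d && ((d == (c.1, c.2.+1)) || (d == (c.1.+1, c.2))).

Lemma childP c d : child c d -> D d /\ (d = (c.1, c.2.+1) \/ d = (c.1.+1, c.2)).
Proof. by case/andP=> Dd /orP[/eqP|/eqP]; split; auto. Qed.

Lemma child_sum c d : child c d -> d.1 + d.2 = (c.1 + c.2).+1.
Proof. by case/childP => _ [] -> /=; lia. Qed.

Lemma child_neq c d : child c d -> (d == c) = false.
Proof. by move/child_sum => E; apply/eqP => X; rewrite X in E; lia. Qed.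

(** The choice of neighbour made inside [slide_aux], isolated so that [slide_auxS] holds by
    computation. *)
Definition small_child (F : nat * nat -> nat) (p : nat * nat) : option (nat * nat) :=
  let r := (p.1, p.2.+1) in
  let b := (p.1.+1, p.2) in
  if D r then (if D b then (if F b < F r then Some b else Some r) else Some r)
  else (if D b then Some b else None).

Lemma slide_auxS fuel F p : slide_aux fuel.+1 lam F p =
  if small_child F p is Some q then
    if F q < F p then slide_aux fuel lam (swapF F p q) q else F
  else F.
Proof. by []. Qed.

Lemma small_childP F p :
  if small_child F p is Some q
  then child p q /\ forall d, child p d -> F q <= F d
  else forall d, ~~ child p d.
Proof.
rewrite /small_child.
case Dr: (D (p.1, p.2.+1)); case Db: (D (p.1.+1, p.2)).
- case: ifP => lt; rewrite /child ?Dr ?Db !eqxx ?orbT; split=> // d.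
    by case/andP=> _ /orP[] /eqP ->; lia.
  by case/andP=> _ /orP[] /eqP ->; lia.
- rewrite /child Dr eqxx; split=> // d /andP[Dd /orP[] /eqP E]; first by rewrite E.
  by rewrite E Db in Dd.
- rewrite /child Db eqxx orbT; split=> // d /andP[Dd /orP[] /eqP E]; last by rewrite E.
  by rewrite E Dr in Dd.
- move=> d; apply/negP=> /andP[Dd /orP[] /eqP E]; first by rewrite E Dr in Dd.
  by rewrite E Db in Dd.
Qed.

Lemma small_child_eq F p q : child p q ->
  (forall d, child p d -> d != q -> F q < F d) -> small_child F p = Some q.
Proof.
move=> pq lt; have := small_childP F p; case: (small_child F p) => [d|].
  case=> pd /(_ q pq) le; congr Some; apply/eqP; apply/negPn/negP => ne.
  by have := lt d pd ne; lia.
by move/(_ q); rewrite pq.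
Qed.

Section Region.

Variables i j : nat.
Hypotheses (i_gt0 : 0 < i) (j_gt0 : 0 < j).

Local Notation z := (i, j).

(* The cells z' with z <= z' in the order of the sorting algorithm. *)
Definition region (c : nat * nat) : bool :=
  D c && ((j < c.2) || ((c.2 == j) && (i <= c.1))).

(** The cells that a slide from z can visit; [region] also contains the cells of later columns above
    row i. *)
Definition quadrant (c : nat * nat) : bool := [&& D c, i <= c.1 & j <= c.2].

Definition sorted_on (F : nat * nat -> nat) : Prop :=
  forall c d, region c -> child c d -> F c < F d.

(* The state of a slide whose moving entry sits in p. *)
Definition sliding (F : nat * nat -> nat) (p : nat * nat) : Prop :=
  [/\ quadrant p,
      forall c d, region c -> child c d -> c != p -> F c < F d &
      forall u d, region u -> child u p -> child p d -> F u < F d].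

(** One step of the backward walk. *)
Definition parent (F : nat * nat -> nat) (c : nat * nat) : nat * nat :=
  if goes_up F j c.1 c.2 then (c.1.-1, c.2) else (c.1, c.2.-1).

Lemma quadrant_region c : quadrant c -> region c.
Proof.
by case/and3P=> Dc ic jc; rewrite /region Dc /=; move: jc; rewrite leq_eqVlt eq_sym ic andbT orbC.
Qed.

Lemma quadrant_child p q : quadrant p -> child p q -> quadrant q.
Proof.
case/and3P=> Dp ip jp /childP[Dq E]; rewrite /quadrant Dq.
by case: E => -> /=; lia.
Qed.

(** The entry that leaves q for p exceeds the entry of any other predecessor of q in the region.
    After the exchange p is thus the larger predecessor of q, and the backward walk returns to the
    cell just left. *)
Lemma sliding_forward F p q : {in D &, injective F} -> sliding F p ->
    child p q -> F q < F p -> (forall d, child p d -> F q <= F d) ->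
  sliding (swapF F p q) q /\ parent (swapF F p q) q = p.
Proof.
move=> injF [Qp H2 H3] pq Fqp qmin.
have Rp := quadrant_region _ Qp; have Qq := quadrant_child _ _ Qp pq.
have Rq := quadrant_region _ Qq.
have qp : q != p by rewrite (child_neq _ _ pq).
have pq' : p != q by rewrite eq_sym.
split; first split => //.
- move=> c d Rc cd cq; have dc := child_neq _ _ cd.
  have [E|cp] := eqVneq c p.
    subst c; rewrite swapFl; have [->|dq] := eqVneq d q; first by rewrite swapFr.
    rewrite swapFo ?dc //; have := qmin d cd.
    rewrite leq_eqVlt => /orP[/eqP E|//].
    case/childP: cd => Dd _; case/childP: pq => Dq _.
    by rewrite (injF _ _ Dq Dd E) eqxx in dq.
  rewrite (swapFo _ _ _ c) //.
  have [E|dp] := eqVneq d p; first by subst d; rewrite swapFl; apply: H3.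
  have [E|dq] := eqVneq d q.
    by subst d; rewrite swapFr; apply: ltn_trans Fqp; apply: H2.
  by rewrite swapFo //; apply: H2.
- move=> u d Ru uq qd.
  have dp : d != p.
    by apply/eqP => E; have := child_sum _ _ qd; have := child_sum _ _ pq; rewrite E; clear; lia.
  have dq : d != q by rewrite (child_neq _ _ qd).
  have uq' : u != q by rewrite eq_sym (child_neq _ _ uq).
  rewrite (swapFo _ _ _ d) //; have [->|up] := eqVneq u p.
    by rewrite swapFl; apply: H2.
  by rewrite swapFo //; apply: (@ltn_trans (F q)); apply: H2.
case: p Qp Rp pq Fqp qmin qp pq' H2 H3 => r x Qp Rp pq Fqp qmin qp pq' H2 H3.
case/and3P: (Qp) => Dp /= ir jx; case/andP: (diagram_pos _ _ Dp) => r1 x1.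
rewrite /parent; case/childP: (pq) => Dq [] E;
  have -> : q.1 = _ := congr1 fst E; have -> : q.2 = _ := congr1 snd E; rewrite /= in E *.
(* A step to the right: the competitor of p is the upper neighbour of q, which lies in the region
   because its column exceeds j. *)
- have -> : goes_up (swapF F (r, x) q) j r x.+1 = false; last by [].
  have -> : goes_up (swapF F (r, x) q) j r x.+1 =
      (1 < r) && (swapF F (r, x) q (r, x) < swapF F (r, x) q (r.-1, x.+1)).
    by rewrite /goes_up; case: leqP => //; clear -jx; lia.
  apply/negP => /andP[r2]; rewrite swapFl.
  have up_q : child (r.-1, x.+1) q.
    by rewrite /child Dq E !xpair_eqE /= prednK ?eqxx ?orbT.
  have D' : D (r.-1, x.+1).
    by rewrite E in Dq; apply: diagram_down Dq _ _ => /=; clear -r1 r2; lia.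
  have R' : region (r.-1, x.+1) by rewrite /region D' /= ltnS jx.
  have n' : (r.-1, x.+1) != (r, x) by rewrite xpair_eqE; clear; lia.
  have n2 : (r.-1, x.+1) != q by rewrite E xpair_eqE; clear -r1; lia.
  by rewrite swapFo //; have := H2 _ _ R' up_q n'; clear; lia.
(* A step down: the competitor is the left neighbour of q; in column j it is outside the region and
   the walk goes up anyway. *)
- have -> : goes_up (swapF F (r, x) q) j r.+1 x = true; last by [].
  rewrite /goes_up ltnS r1 /= swapFl; case: (leqP x j) => //= xj.
  have left_q : child (r.+1, x.-1) q.
    by rewrite /child Dq E !xpair_eqE /= prednK ?eqxx.
  have D' : D (r.+1, x.-1).
    by rewrite E in Dq; apply: diagram_down Dq _ _ => /=; clear -x1 xj j_gt0; lia.
  have R' : region (r.+1, x.-1) by rewrite /region D' /=; clear -ir xj; lia.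
  have n' : (r.+1, x.-1) != (r, x) by rewrite xpair_eqE; clear; lia.
  have n2 : (r.+1, x.-1) != q by rewrite E xpair_eqE; clear -x1; lia.
  by rewrite swapFo //; apply: H2.
Qed.

Lemma parent_child F p : quadrant p -> quadrant (parent F p) -> child (parent F p) p.
Proof.
case: p => r x Qp Qq; case/and3P: Qp => Dp /= ir jx.
rewrite /child Dp /=; case/and3P: Qq; rewrite /parent /=.
case: ifP => _ /=; rewrite !xpair_eqE /=; lia.
Qed.

Lemma parent_max F p u : {in D &, injective F} -> quadrant p -> quadrant (parent F p) ->
  region u -> child u p -> u != parent F p -> F u < F (parent F p).
Proof.
case: p => r x injF Qp Qq; case/and3P: (Qp) => Dp /= ir jx.
case/and3P: (Qq) => Dq iq jq Ru.
case/childP => _ E; case: u Ru E => u1 u2 Ru /= E.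
have : (u1, u2) = (r, x.-1) /\ 0 < x \/ (u1, u2) = (r.-1, x) /\ 0 < r.
  by case: E => -[-> ->] /=; [left | right].
case/andP: (Ru) => Du /= Ru2; case/andP: (diagram_pos _ _ Du) => u1p u2p.
move: Dq jq iq; rewrite /parent /=; case: ifP => /= up Dq jq iq [] [E2 pos] neq.
- case: E2 => e1 e2; rewrite e1 e2 in neq Du u1p u2p Ru2 *.
  move: up; rewrite /goes_up; case: (leqP x j) => xj /=.
    by move: Ru2 pos jx xj; clear; lia.
  by case/andP.
- by rewrite E2 eqxx in neq.
- by rewrite E2 eqxx in neq.
- case: E2 => e1 e2; rewrite e1 e2 in neq Du u1p *.
  move: up; rewrite /goes_up; case: (leqP x j) => //= xj.
  have -> : 1 < r by move: u1p; clear; lia.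
  move=> /= /negbT; rewrite -leqNgt leq_eqVlt; case/orP => // /eqP E3.
  by rewrite (injF _ _ Du Dq E3) eqxx in neq.
Qed.

(** The walk picks the larger predecessor q, so moving the entry of q into p respects the other
    predecessor of p. Having come from q, this entry is below the other child of q, so a slide
    arriving in q would step to p. *)
Lemma sliding_backward F p : {in D &, injective F} -> sliding F p ->
    quadrant (parent F p) ->
  let q := parent F p in let F1 := swapF F p q in
  [/\ sliding F1 q, child q p, F1 p < F1 q
    & forall d, child q d -> d != p -> F1 p < F1 d].
Proof.
move=> injF [Qp H2 H3] Qq q F1; rewrite /F1.
have qp := parent_child _ _ Qp Qq; have pmax u := parent_max _ _ u injF Qp Qq.
rewrite -/q in Qq qp pmax.
have Rp := quadrant_region _ Qp; have Rq := quadrant_region _ Qq.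
have nqp : q != p by rewrite eq_sym (child_neq _ _ qp).
have npq : p != q by rewrite eq_sym.
have Fqp : F q < F p by apply: H2.
split => //; last first.
- move=> d qd dp; rewrite swapFl swapFo //; first exact: H2.
  by rewrite (child_neq _ _ qd).
- by rewrite swapFl swapFr.
split => //.
- move=> c d Rc cd cq; have dc := child_neq _ _ cd.
  have [E|cp] := eqVneq c p.
    subst c; rewrite swapFl swapFo ?dc //; first exact: H3.
    apply/eqP => E; have := child_sum _ _ qp; have := child_sum _ _ cd.
    by rewrite E; clear; lia.
  rewrite (swapFo _ _ _ c) //.
  have [E|dp] := eqVneq d p; first by subst d; rewrite swapFl; apply: pmax.
  have [E|dq] := eqVneq d q.
    by subst d; rewrite swapFr; apply: ltn_trans Fqp; apply: H2.
  by rewrite swapFo //; apply: H2.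
- move=> u d Ru uq qd.
  have up : u != p.
    by apply/eqP => E; have := child_sum _ _ uq; have := child_sum _ _ qp; rewrite E; clear; lia.
  have uq' : u != q by rewrite eq_sym (child_neq _ _ uq).
  have dq : d != q by rewrite (child_neq _ _ qd).
  rewrite (swapFo _ _ _ u) //; have [->|dp] := eqVneq d p.
    by rewrite swapFl; apply: H2.
  by rewrite swapFo //; apply: (@ltn_trans (F q)); apply: H2.
Qed.

(** The state pairs a filling with the cell of its moving entry. The parent is read off in the
    current filling; [unslide_iter] shows that it agrees with the walk in the original one. *)
Definition unslide_step (s : (nat * nat -> nat) * (nat * nat)) :=
  (swapF s.1 s.2 (parent s.1 s.2), parent s.1 s.2).

Lemma mem_cells c : (c \in cells lam) = D c.
Proof.
rewrite mem_filter; case Dc: (D c) => //=; apply/allpairsP.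
exists (c.2, c.1); split; last by case: (c).
  case: c Dc => r x; rewrite /in_diagram /= => /andP[/andP[r1 x1] xl].
  rewrite mem_iota x1 /= -nth0; have := nth_part_anti 0 r.-1 (leq0n _).
  by move: xl; clear; lia.
case: c Dc => r x; rewrite /in_diagram /= => /andP[/andP[r1 x1] xl].
rewrite mem_iota r1 /=; case: (ltnP r.-1 (size lam)) => [|sr].
  by move: r1; clear; lia.
by rewrite nth_default // in xl; move: x1 xl; clear; lia.
Qed.

Lemma cells_uniq : uniq (cells lam).
Proof.
rewrite filter_uniq // allpairs_uniq ?iota_uniq //.
by case=> a b [a' b'] _ _ [-> ->].
Qed.

(** Column 1 down to row r followed by row r up to column x gives r + x - 1 cells of the diagram.
    This is the bound behind the fuel of [slide]. *)
Lemma diagram_size r x : D (r, x) -> r + x <= (size (cells lam)).+1.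
Proof.
move=> Dp; case/andP: (diagram_pos _ _ Dp) => r1 x1.
pose hook := [seq (a, 1) | a <- iota 1 r] ++ [seq (r, b) | b <- iota 2 x.-1].
have : size hook <= size (cells lam).
  apply: uniq_leq_size.
    rewrite cat_uniq !map_inj_uniq ?iota_uniq /=; last 2 first.
    - by move=> a b [].
    - by move=> a b [].
    rewrite andbT; apply/hasPn => c /mapP[b]; rewrite mem_iota => bb ->.
    by apply/mapP => -[a _ [_ E]]; move: bb; rewrite E.
  move=> c; rewrite mem_cat => /orP[] /mapP[a]; rewrite mem_iota => aa ->;
  rewrite mem_cells; apply: diagram_down Dp _ _; move: aa r1 x1; clear; lia.
by rewrite size_cat !size_map !size_iota; move: r1 x1; clear; lia.
Qed.

Definition chain (F : nat * nat -> nat) (c : nat * nat) (m : nat) := iter m (parent F) c.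

(** Each backward step lowers the coordinate sum by one, so a walk from c to z takes exactly this
    number of steps. *)
Definition unslide (F : nat * nat -> nat) (c : nat * nat) : nat * nat -> nat :=
  (iter (c.1 - i + (c.2 - j)) unslide_step (F, c)).1.

Lemma chain_sum F c m : (forall l, l <= m -> quadrant (chain F c l)) ->
  (chain F c m).1 + (chain F c m).2 + m = c.1 + c.2.
Proof.
elim: m => [|m IH] Qc; first by rewrite addn0.
have Qm := Qc m (leqnSn m); have Qm1 := Qc m.+1 (leqnn _).
have := child_sum _ _ (parent_child _ _ Qm Qm1).
rewrite -IH; last by move=> l lm; apply: Qc; exact: leqW.
rewrite [chain F c m.+1]/=; clear; rewrite -/(chain F c m); lia.
Qed.

Lemma chain_le F c l m : l <= m ->
  ((chain F c m).1 <= (chain F c l).1) && ((chain F c m).2 <= (chain F c l).2).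
Proof.
move=> lm; rewrite -(subnK lm); elim: (m - l) => [|k /andP[IH1 IH2]].
  by rewrite !leqnn.
rewrite addSn [chain F c (k + l).+1]/= -/(chain F c (k + l)).
move: (chain F c (k + l)) IH1 IH2 => p IH1 IH2.
by rewrite /parent; case: ifP => _ /=; move: IH1 IH2; clear; lia.
Qed.

(** The exchanges made so far only touch cells whose coordinate sum is at least that of the current
    cell, whereas the next parent is decided by cells of smaller sum. The walk in the modified
    filling is therefore the chain in F, and the entries are shifted by one place along it. *)
Lemma unslide_iter F c m : {in D &, injective F} -> sliding F c ->
    (forall l, l <= m -> quadrant (chain F c l)) ->
  let s := iter m unslide_step (F, c) in
  [/\ s.2 = chain F c m, sliding s.1 s.2, {in D &, injective s.1}
    & forall fuel, slide_aux (m + fuel) lam s.1 s.2 = slide_aux fuel lam F c] /\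
  [/\ s.1 (chain F c m) = F c,
      forall l, l < m -> s.1 (chain F c l) = F (chain F c l.+1) &
      forall d, (forall l, l <= m -> d != chain F c l) -> s.1 d = F d].
Proof.
move=> injF slF; elim: m => [|m IH] Qc; first by [].
have Qc' l : l <= m -> quadrant (chain F c l) by move=> lm; apply: Qc; exact: leqW.
have Qm := Qc' m (leqnn m); have Qm1 := Qc m.+1 (leqnn _).
have sm : forall l, l <= m -> (chain F c l).1 + (chain F c l).2 + l = c.1 + c.2.
  by move=> l lm; apply: chain_sum => l' l'l; apply: Qc'; exact: leq_trans lm.
have sum_l l : l <= m ->
    (chain F c m).1 + (chain F c m).2 <= (chain F c l).1 + (chain F c l).2.
  by move=> lm; case/andP: (chain_le F c _ _ lm); clear; lia.
have {IH} := IH Qc'; rewrite iterS; case: (iter m unslide_step (F, c)) => G p /=.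
case=> -[Ep slG injG slideG] [G_end G_mid G_off]; subst p.
have [p1 p2] : 0 < (chain F c m).1 /\ 0 < (chain F c m).2.
  by case/and3P: Qm; move: i_gt0 j_gt0; clear; lia.
have off d : d.1 + d.2 < (chain F c m).1 + (chain F c m).2 -> G d = F d.
  move=> lt; apply: G_off => l lm; apply/eqP => E; have := sum_l l lm.
  by move: lt; rewrite E; clear; lia.
have par : parent G (chain F c m) = chain F c m.+1.
  rewrite /= -/(chain F c m) /parent /goes_up !off //=.
    by move: p1 p2; clear; lia.
  by move: p1 p2; clear; lia.
have Qpar : quadrant (parent G (chain F c m)) by rewrite par.
have [slG1 chi lt_c min_c] := sliding_backward _ _ injG slG Qpar.
rewrite par in slG1 chi lt_c min_c *.
have ne_q l : l <= m -> chain F c l != chain F c m.+1.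
  move=> lm; apply/eqP => E; have := sum_l l lm; have := child_sum _ _ chi.
  by rewrite E; clear; lia.
have ne_m l : l < m -> chain F c l != chain F c m.
  move=> lm; apply/eqP => E; have := sm l (ltnW lm); have := sm m (leqnn m).
  by rewrite E; move: lm; clear; lia.
have slideG1 fuel : slide_aux (m.+1 + fuel) lam
    (swapF G (chain F c m) (chain F c m.+1)) (chain F c m.+1) = slide_aux fuel lam F c.
  rewrite addSn slide_auxS (small_child_eq _ _ _ chi min_c) lt_c.
  by rewrite swapFK slideG.
split; split => //.
- by apply: swapF_inj => //; [case/and3P: Qm | case/and3P: Qm1].
- exact: etrans (swapFr _ _ _) G_end.
- move=> l; rewrite ltnS leq_eqVlt => /orP[/eqP->|lm].
    rewrite swapFl off //; have := child_sum _ _ chi; clear; lia.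
  by rewrite swapFo ?ne_m ?ne_q ?G_mid //; exact: ltnW.
- move=> d dn; rewrite swapFo ?G_off //; first by move=> l lm; apply: dn; exact: leqW.
    exact: dn.
  exact: (dn m.+1).
Qed.

Lemma sorted_sliding F c : sorted_on F -> quadrant c -> sliding F c.
Proof.
move=> sF Qc; split=> // [c' d Rc cd _|u d Ru uc cd]; first exact: sF.
by apply: (@ltn_trans (F c)); apply: sF => //; apply: quadrant_region.
Qed.

Lemma slide_aux_sorted fuel F c : sorted_on F -> quadrant c ->
  slide_aux fuel lam F c = F.
Proof.
case: fuel => // fuel sF Qc; rewrite slide_auxS.
have := small_childP F c; case: (small_child F c) => // q [cq _].
by rewrite ltnNge ltnW // sF // quadrant_region.
Qed.

(** Fuel plus coordinate sum is constant along the slide and exceeds the bound of [diagram_size], so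
    the slide stops only for lack of a smaller child. Each step is undone by one [unslide_step]
    according to [sliding_forward]. *)
Lemma slide_aux_end fuel F p : {in D &, injective F} -> sliding F p ->
    (size (cells lam)).+1 < fuel + (p.1 + p.2) ->
  sorted_on (slide_aux fuel lam F p) /\
  exists c m, iter m unslide_step (slide_aux fuel lam F p, c) = (F, p) /\
    forall l, l <= m ->
      quadrant (iter l unslide_step (slide_aux fuel lam F p, c)).2.
Proof.
elim: fuel F p => [|fuel IH] F p injF slF bound.
  case: slF => /and3P[Dp _ _] _ _; case: p Dp bound => r x /diagram_size /=.
  by clear; lia.
have [Qp H2 H3] := slF.
have stop : (forall d, child p d -> F p < F d) ->
    sorted_on F /\ exists c m, iter m unslide_step (F, c) = (F, p) /\
    forall l, l <= m -> quadrant (iter l unslide_step (F, c)).2.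
  move=> pmin; split=> [c d Rc cd|].
    by have [E|cp] := eqVneq c p; [subst c; apply: pmin | apply: H2].
  by exists p, 0; split=> // l; rewrite leqn0 => /eqP->.
rewrite slide_auxS; have := small_childP F p.
case: (small_child F p) => [q [pq qmin]|none]; last first.
  by apply: stop => d pd; rewrite (negPf (none d)) in pd.
have ne : F q != F p.
  apply/eqP => E; case/childP: (pq) => Dq _; case/and3P: Qp => Dp _ _.
  by have := child_neq _ _ pq; rewrite (injF _ _ Dq Dp E) eqxx.
case: ifP => [lt|/negbT]; last first.
  rewrite -leqNgt leq_eqVlt eq_sym (negPf ne) /= => lt.
  by apply: stop => d /qmin; exact: leq_trans.
have [slF1 par] := sliding_forward _ _ _ injF slF pq lt qmin.
have injF1 : {in D &, injective (swapF F p q)}.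
  by apply: swapF_inj => //; [case/and3P: Qp | case/childP: pq].
case: (IH _ _ injF1 slF1) => [|sorted_end [c [m [iter_m quad_m]]]].
  by have := child_sum _ _ pq; move: bound; clear; lia.
split=> //; exists c, m.+1; split=> [|l].
  by rewrite iterS iter_m /unslide_step /= par swapFK.
rewrite leq_eqVlt => /orP[/eqP->|]; last by rewrite ltnS; apply: quad_m.
by rewrite iterS iter_m /unslide_step /= par.
Qed.

(** With [row_chain] this identifies the stepwise walk [chain] with its row segments, which extend
    from [exit_col] to [enter_col]. *)
Lemma chain_row F c l : (forall l', l' <= l -> quadrant (chain F c l')) ->
  let p := chain F c l in
  [/\ p.1 <= c.1, exit_col F j p.1 (enter_col F j c p.1) <= p.2 &
      p.2 <= enter_col F j c p.1].
Proof.
elim: l => [|l IH] Qc; first by rewrite /= enter_col_start exit_col_le.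
have {IH}/= [] := IH (fun l' ll => Qc l' (leqW ll)).
have := Qc l.+1 (leqnn _); rewrite [chain F c l.+1]/= -/(chain F c l).
have := Qc l (leqnSn _).
case: (chain F c l) => r x /=; rewrite /parent /=.
set b := enter_col F j c r => Q1 Q2 rc ex xb.
case: ifP Q2 => [up|up] Q2 /=; last first.
  split=> //; last exact: leq_trans (leq_pred _) xb.
  have : exit_col F j r b != x.
    by apply/eqP => E; have := goes_up_exit F j r b; rewrite E up.
  by rewrite -/b; move: ex; clear; lia.
have xE : exit_col F j r b = x by apply/eqP; rewrite eqn_leq ex exit_col_max.
have rE : r = r.-1.+1 by case/and3P: Q1; move: i_gt0; clear; rewrite /=; lia.
have entE : enter_col F j c r.-1 = x.
  by rewrite enter_colS -?rE.
by rewrite entE exit_col_le; split=> //; move: rc; clear; lia.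
Qed.

Lemma row_chain F c r x : r <= c.1 ->
    exit_col F j r (enter_col F j c r) <= x <= enter_col F j c r ->
  chain F c (c.1 - r + (c.2 - x)) = (r, x).
Proof.
(* Leftward inside one row, starting where the walk enters it. *)
have row r' : r' <= c.1 ->
    chain F c (c.1 - r' + (c.2 - enter_col F j c r')) = (r', enter_col F j c r') ->
    forall k, exit_col F j r' (enter_col F j c r') <= enter_col F j c r' - k ->
    chain F c (c.1 - r' + (c.2 - (enter_col F j c r' - k))) =
      (r', enter_col F j c r' - k).
  move=> r'c start; elim=> [|k IH]; first by rewrite subn0.
  have bc := enter_col_le F j c r'.
  set b := enter_col F j c r' in start IH bc * => ek.
  case: (ltnP k b) => kb; last first.
    have E : b - k.+1 = b - k by move: kb; clear; lia.
    by rewrite E in ek *; apply: IH.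
  have -> : c.1 - r' + (c.2 - (b - k.+1)) = (c.1 - r' + (c.2 - (b - k))).+1.
    by move: kb bc; clear; lia.
  rewrite [chain _ _ _]/= -/(chain F c (c.1 - r' + (c.2 - (b - k)))) IH; last first.
    by move: ek; clear; lia.
  rewrite /parent /=; case: ifP => [up|_].
    have := exit_col_max F j r' b (b - k) (leq_subr _ _) up.
    by move: ek kb; clear; lia.
  by congr (_, _); move: kb; clear; lia.
(* Upward from row to row, each row being left at its exit column. *)
have start k : k <= c.1 -> chain F c (k + (c.2 - enter_col F j c (c.1 - k))) =
    (c.1 - k, enter_col F j c (c.1 - k)).
  elim: k => [|k IH] kc; first by rewrite subn0 enter_col_start subnn; case: (c).
  have rE : c.1 - k = (c.1 - k.+1).+1 by move: kc; clear; lia.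
  have eE : enter_col F j c (c.1 - k.+1) = exit_col F j (c.1 - k) (enter_col F j c (c.1 - k)).
    by rewrite enter_colS -?rE //; move: kc; clear; lia.
  have le := exit_col_le F j (c.1 - k) (enter_col F j c (c.1 - k)).
  have := row (c.1 - k) (leq_subr _ _).
  have -> : c.1 - (c.1 - k) = k by move: kc; clear; lia.
  move=> /(_ (IH (ltnW kc))).
  move=> /(_ (enter_col F j c (c.1 - k) - enter_col F j c (c.1 - k.+1))).
  rewrite -eE in le *; rewrite subKn // leqnn => /(_ isT) E.
  rewrite addSn [chain _ _ _]/= -/(chain F c (k + (c.2 - enter_col F j c (c.1 - k.+1)))) E.
  rewrite /parent /= eE goes_up_exit; congr (_, _).
  by move: kc; clear; lia.
move=> rc /andP[ex xb].
have := start (c.1 - r) (leq_subr _ _); rewrite subKn // => st.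
by have := row r rc st (enter_col F j c r - x); rewrite subKn //; apply.
Qed.

Lemma reaches_chain F c : quadrant c -> reaches F j i c ->
  chain F c (c.1 - i + (c.2 - j)) = z /\
  forall l, l <= c.1 - i + (c.2 - j) -> quadrant (chain F c l).
Proof.
move=> Qc /eqP re; case/and3P: (Qc) => Dc ic jc.
have end_z : chain F c (c.1 - i + (c.2 - j)) = z.
  by apply: row_chain => //; rewrite re leqnn enter_col_ge.
split=> // l lm; have := chain_le F c _ _ lm; rewrite end_z.
have := chain_le F c _ _ (leq0n l); rewrite [chain F c 0]/=.
case: c Dc {Qc re ic jc end_z lm} => r x Dc.
case: (chain F _ l) => r' x' /= le1 le2.
rewrite /quadrant /= le2 andbT.
by apply: diagram_down Dc _ _; move: i_gt0 j_gt0 le1 le2; clear; lia.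
Qed.

Lemma chain_reaches F c m : (forall l, l <= m -> quadrant (chain F c l)) ->
  chain F c m = z -> reaches F j i c.
Proof.
move=> Qc E; have [] := chain_row F c m Qc; rewrite E /= => ic ex _.
rewrite /reaches eqn_leq ex /=; apply/exit_col_ge/enter_col_ge.
by case/and3P: (Qc 0 (leq0n m)).
Qed.

(** The shift along the chain, rewritten in row segments: this form allows walks before and after
    undoing to be compared. The slide gives back F because F is sorted, so the remaining fuel has no
    effect. *)
Lemma unslideP F c : {in D &, injective F} -> sorted_on F -> quadrant c ->
    reaches F j i c ->
  [/\ sliding (unslide F c) z, slide lam (unslide F c) z = F,
      unslide F c z = F c
    & forall r x, i <= r <= c.1 ->
        exit_col F j r (enter_col F j c r) < x <= enter_col F j c r ->
        unslide F c (r, x) = F (r, x.-1)] /\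
  (forall r, i < r <= c.1 -> let x := exit_col F j r (enter_col F j c r) in
        unslide F c (r, x) = F (r.-1, x)) /\
  (forall r x, [|| r < i, c.1 < r, x < exit_col F j r (enter_col F j c r)
                 | enter_col F j c r < x] ->
        unslide F c (r, x) = F (r, x)).
Proof.
move=> injF sF Qc re; have [chz Qch] := reaches_chain _ _ Qc re.
have [] := unslide_iter _ _ _ injF (sorted_sliding _ _ sF Qc) Qch.
rewrite /unslide; set s := iter _ _ _; rewrite /= chz.
case: (Qc) => /and3P[Dc ic jc] [s2 sl _ slideE] [T_end T_mid T_off].
have Ts r x l : l < c.1 - i + (c.2 - j) -> chain F c l = (r, x) ->
    s.1 (r, x) = F (parent F (r, x)) by move=> lm <-; exact: T_mid.
have boundc : c.1 + c.2 <= (size (cells lam)).+1.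
  by case: (c) Dc => r x; exact: diagram_size.
split; split=> //.
- by rewrite -s2.
- rewrite /slide -s2 -(subnK (_ : c.1 - i + (c.2 - j) <= size (cells lam))).
    by rewrite addnC slideE slide_aux_sorted.
  by move: boundc i_gt0 j_gt0 ic jc; clear; lia.
- move=> r x /andP[ir rc] /andP[ex xb].
  have xc := leq_trans xb (enter_col_le F j c r).
  have jx : j <= exit_col F j r (enter_col F j c r) by apply/exit_col_ge/enter_col_ge.
  rewrite (Ts _ _ (c.1 - r + (c.2 - x))); last by rewrite row_chain // xb ltnW.
    rewrite /parent /=; case: ifP => // up.
    have := exit_col_max F j r _ _ xb up.
    by move: ex; clear; lia.
  by move: ir rc ex jx xc; clear; lia.
- move=> r /andP[ir rc]; set x := exit_col F j r _.
  have jx : j <= x by apply/exit_col_ge/enter_col_ge.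
  have xb : x <= enter_col F j c r by exact: exit_col_le.
  have xc := leq_trans xb (enter_col_le F j c r).
  rewrite (Ts _ _ (c.1 - r + (c.2 - x))); last by rewrite row_chain // xb leqnn.
    by rewrite /parent /= goes_up_exit.
  by move: ir rc jx xc; clear; lia.
move=> r x off; apply: T_off => l lm; apply/eqP => E.
have [] := chain_row F c l (fun l' ll => Qch l' (leq_trans ll lm)).
have := Qch l lm; rewrite -E /= => /and3P[_ /= ir _].
by move: off ir; clear; lia.
Qed.

Lemma slideP T : {in D &, injective T} -> sliding T z ->
  sorted_on (slide lam T z) /\
  exists c, [/\ quadrant c, reaches (slide lam T z) j i c &
                unslide (slide lam T z) c = T].
Proof.
move=> injT slT; rewrite /slide.
have [|sF [c [m [iter_m quad_m]]]] := slide_aux_end (size (cells lam)) _ _ injT slT.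
  by move: i_gt0 j_gt0; clear => /=; lia.
split=> //; exists c.
set F := slide_aux _ _ _ _ in sF iter_m quad_m *.
have injF : {in D &, injective F}.
  rewrite /F; elim: (size _) (T) (z) injT slT => [|k IH] G p injG slG //.
  rewrite slide_auxS; have := small_childP G p.
  case: (small_child G p) => // q [pq qmin]; case: ifP => // lt.
  have [sl1 _] := sliding_forward _ _ _ injG slG pq lt qmin.
  apply: IH => //; apply: swapF_inj => //; last by case/childP: pq.
  by case: slG => /and3P[].
have Qc : quadrant c := quad_m 0 (leq0n m).
have slc := sorted_sliding _ _ sF Qc.
(* [quad_m] speaks of cells visited in successively modified fillings; by strong induction these are
   the cells of the chain in F. *)
have Qch l : l <= m -> quadrant (chain F c l).
  elim: l {-2}l (leqnn l) => [|k IH] l lk lm.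
    by move: lk; rewrite leqn0 => /eqP->.
  case: (ltnP l k.+1) => [lk'|kl]; first exact: IH.
  have {lk kl} E : l = k.+1 by apply/eqP; rewrite eqn_leq lk kl.
  subst l.
  have [] := unslide_iter F c k injF slc; first by move=> l lk; apply: IH; lia.
  case=> s2 slk injk _ [_ _ T_off].
  have := quad_m k.+1 lm; rewrite iterS; move: s2 slk injk T_off.
  have := quad_m k (ltnW lm).
  case: (iter k unslide_step (F, c)) => G p /= Qp Ep slG injG T_off; subst p.
  suff -> : parent G (chain F c k) = parent F (chain F c k) by [].
  have [p1 p2] : 0 < (chain F c k).1 /\ 0 < (chain F c k).2.
    by case/and3P: Qp; move: i_gt0 j_gt0; clear; lia.
  have off d : d.1 + d.2 < (chain F c k).1 + (chain F c k).2 -> G d = F d.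
    move=> lt; apply: T_off => l lk; apply/eqP => E.
    case/andP: (chain_le F c _ _ lk); move: lt; rewrite E; clear; lia.
  by rewrite /parent /goes_up !off //=; move: p1 p2; clear; lia.
have [[s2 _ _ _] _] := unslide_iter F c m injF slc Qch.
rewrite iter_m /= in s2.
have mE : m = c.1 - i + (c.2 - j).
  have := chain_sum F c m Qch; rewrite -s2 /=.
  by case/and3P: Qc; clear; lia.
split=> //; first by apply: chain_reaches Qch _.
by rewrite /unslide -mE iter_m.
Qed.

(** The walk of d is squeezed between column j and the walk of c. *)
Lemma path_lt_reaches F c d : quadrant c -> quadrant d -> reaches F j i c ->
  path_lt F j d c -> reaches F j i d.
Proof.
move=> /and3P[_ ic jc] /and3P[_ id jd] /eqP re lt.
rewrite /reaches eqn_leq exit_col_ge ?enter_col_ge // andbT -[X in _ <= X]re.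
exact/exit_col_mono/path_lt_enter.
Qed.

(** * The weight of a sorted filling *)

Section Unslid.

Variables (F : nat * nat -> nat) (c : nat * nat).
Hypotheses (injF : {in D &, injective F}) (sF : sorted_on F).
Hypotheses (Qc : quadrant c) (rc : reaches F j i c).

Local Notation T := (unslide F c).
Local Notation b := (enter_col F j c).
Local Notation a r := (exit_col F j r (enter_col F j c r)).

Lemma on_path_ge r : (j <= a r) && (j <= b r).
Proof.
by case/and3P: Qc => _ _ jc; rewrite exit_col_ge enter_col_ge.
Qed.

Lemma on_path_diagram r x : i <= r <= c.1 -> j <= x <= b r -> D (r, x).
Proof.
move=> /andP[ir rc'] /andP[jx xb]; case/and3P: Qc => Dc _ _.
have := enter_col_le F j c r.
case: (c) Dc rc' xb => r' x' Dc /= rc' xb bx'.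
by apply: diagram_down Dc _ _; move: i_gt0 j_gt0 ir rc' jx xb bx'; clear; lia.
Qed.

Lemma sorted_right r x : i <= r -> j <= x -> D (r, x.+1) -> F (r, x) < F (r, x.+1).
Proof.
move=> ir jx Dp; apply: sF; last by rewrite /child Dp eqxx.
apply: quadrant_region; rewrite /quadrant /= ir jx !andbT.
by apply: diagram_down Dp _ _; move: i_gt0 j_gt0 ir jx; clear; lia.
Qed.

Lemma sorted_below r x : i <= r -> j <= x -> D (r.+1, x) -> F (r, x) < F (r.+1, x).
Proof.
move=> ir jx Dp; apply: sF; last by rewrite /child Dp eqxx orbT.
apply: quadrant_region; rewrite /quadrant /= ir jx !andbT.
by apply: diagram_down Dp _ _; move: i_gt0 j_gt0 ir jx; clear; lia.
Qed.

(** For [a r < y <= b r], the cell (r, y) of T holds F (r, y - 1), which is below the entry F (r +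
    1, y - 1) left of (r + 1, y): no walk turns up there. In column [a r.+1 + 1] the left neighbour
    holds F (r, [a r.+1]), which is below the unchanged entry above: walks from the right turn up
    there at the latest. *)
Lemma exit_col_unslide r x : i <= r < c.1 -> j <= x -> D (r.+1, x) ->
  (exit_col T j r.+1 x <= a r) = (x <= a r.+1).
Proof.
move=> /andP[ir rc'] jx Dx; have [[_ _ _ T_left] [T_up T_off]] := unslideP _ _ injF sF Qc rc.
have bE : b r = a r.+1 by rewrite enter_colS.
have /andP[ja jb] := on_path_ge r; have /andP[ja' jb'] := on_path_ge r.+1.
case: (leqP x (a r.+1)) => xa.
  rewrite leqNgt; apply/negP => lt.
  have := goes_up_exit T j r.+1 x; have := exit_col_le T j r.+1 x.
  move: lt; set y := exit_col T j r.+1 x => ay yx; apply/negP.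
  rewrite /goes_up negb_or -ltnNge (leq_ltn_trans ja ay) /= ltnS negb_and.
  rewrite -!leqNgt (T_left r y) ?(T_off r.+1); last 3 first.
  - by move: ay yx xa; clear; lia.
  - by move: ir rc'; clear; lia.
  - by rewrite ay bE (leq_trans yx xa).
  apply/orP; right; apply: ltnW; apply: sorted_below => //; first by move: ja ay; clear; lia.
  apply: on_path_diagram; first by move: ir rc'; clear; lia.
  have := exit_col_le F j r.+1 (b r.+1).
  by move: ja ay yx xa; clear; lia.
apply/negbTE; rewrite -ltnNge.
have : a r.+1 < exit_col T j r.+1 x; last first.
  by apply: leq_ltn_trans; rewrite -bE; apply: exit_col_le.
apply: exit_col_max => //; rewrite /goes_up /= ltnS.
rewrite T_up ?(T_off r) /=; last 2 first.
- by rewrite bE ltnSn !orbT.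
- by move: ir rc'; clear; lia.
rewrite (leq_trans i_gt0 ir) sorted_right ?orbT //.
by apply: diagram_down Dx _ _; move: i_gt0 ir xa; clear; lia.
Qed.

(** Right of column [c.2] the turning rule is the same for T and F. In the columns between [a c.1]
    and [c.2] the shifted row c.1 prevents T-walks from turning up, so a walk that gets to column
    [c.2] continues to [a c.1] or beyond. *)
Lemma exit_col_unslide_below x : j <= x -> D (c.1.+1, x) ->
  (exit_col T j c.1.+1 x <= a c.1) = (exit_col F j c.1.+1 x <= c.2).
Proof.
move=> jx Dx; have [[_ _ _ T_left] [T_up T_off]] := unslideP _ _ injF sF Qc rc.
case/and3P: Qc => Dc ic jc.
have bE : b c.1 = c.2 by exact: enter_col_start.
have /andP[ja _] := on_path_ge c.1.
have upE y : c.2 < y -> goes_up T j c.1.+1 y = goes_up F j c.1.+1 y.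
  move=> cy; have E1 : T (c.1.+1, y.-1) = F (c.1.+1, y.-1).
    by apply: T_off; rewrite ltnSn orbT.
  have E2 : T (c.1, y) = F (c.1, y) by apply: T_off; rewrite bE cy !orbT.
  by rewrite /goes_up [_.+1.-1]/= E1 E2.
have noup y : a c.1 < y -> y <= c.2 -> y <= x -> ~~ goes_up T j c.1.+1 y.
  move=> ay yc yx.
  rewrite /goes_up negb_or -ltnNge (leq_ltn_trans ja ay) /= ltnS negb_and.
  rewrite -!leqNgt (T_left c.1 y) ?(T_off c.1.+1); last 3 first.
  - by rewrite ltnSn orbT.
  - by rewrite ic leqnn.
  - by rewrite ay bE yc.
  apply/orP; right; apply: ltnW; apply: sorted_below => //; first by move: ja ay; clear; lia.
  by apply: diagram_down Dx _ _; move: j_gt0 ja ay yx; clear; lia.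
have ac : a c.1 <= c.2 by apply: leq_trans (exit_col_le _ _ _ _) _; rewrite bE.
have := goes_up_exit T j c.1.+1 x; have := exit_col_le T j c.1.+1 x.
have := goes_up_exit F j c.1.+1 x; have := exit_col_le F j c.1.+1 x.
move=> xF uF xT uT.
apply/idP/idP => le; rewrite leqNgt; apply/negP => lt.
  have := exit_col_max T j c.1.+1 x _ xF; rewrite upE // uF => /(_ isT).
  by move: le lt ac; clear; lia.
case: (leqP (exit_col T j c.1.+1 x) c.2) => lt2.
  by move/negP: (noup _ lt lt2 xT).
have := exit_col_max F j c.1.+1 x _ xT; rewrite -upE // uT => /(_ isT).
by move: le lt2; clear; lia.
Qed.

Lemma enter_diagram G d r : quadrant d -> 0 < r <= d.1 ->
  (j <= enter_col G j d r) && D (r, enter_col G j d r).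
Proof.
case: d => r' x' /and3P[Dd /= id jd] /andP[r0 rd].
have := enter_col_ge G j (r', x') r jd; have := enter_col_le G j (r', x') r.
move=> /= le ge; rewrite ge; apply: diagram_down Dd _ _; first by rewrite r0.
by rewrite le (leq_trans j_gt0 ge).
Qed.

(** Descending induction on the walk is run upwards in r: [exit_col_unslide] transfers the criterion
    from row r to row r + 1, and the base is [a i = j], which says that c reaches z. *)
Lemma reaches_unslide_row d r : quadrant d -> i < r -> r <= d.1 -> r <= c.1 ->
  reaches T j i.+1 d = (enter_col T j d r <= a r).
Proof.
move=> Qd; have aE : a i = j by exact/eqP.
have base : i < d.1 -> i < c.1 ->
    reaches T j i.+1 d = (enter_col T j d i.+1 <= a i.+1).
  move=> id ic; have /andP[je De] := enter_diagram T d i.+1 Qd id.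
  by rewrite -exit_col_unslide ?leqnn //= aE /reaches eqn_leq exit_col_ge // andbT.
elim: r => // r IH ir rd rc'.
move: ir; rewrite ltnS leq_eqVlt => /orP[/eqP E|ir].
  by rewrite -E in rd rc' *; exact: base.
have /andP[je De] := enter_diagram T d r.+1 Qd rd.
rewrite IH ?(ltnW rd) ?(ltnW rc') // enter_colS // exit_col_unslide //.
by rewrite ltnW.
Qed.

Lemma reaches_unslide_above d : quadrant d -> i < d.1 <= c.1 ->
  reaches T j i.+1 d = (d.2 <= b d.1.-1).
Proof.
move=> Qd /andP[id dc]; rewrite (reaches_unslide_row d d.1) // enter_col_start.
have E : d.1 = d.1.-1.+1 by move: id; clear; lia.
by rewrite [b d.1.-1]enter_colS -?E.
Qed.

(** T and F agree below row c.1, so the walks of d coincide until they enter row c.1 + 1; there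
    [exit_col_unslide_below] applies. *)
Lemma reaches_unslide_below d : quadrant d -> c.1 < d.1 ->
  reaches T j i.+1 d = path_lt F j d c.
Proof.
move=> Qd cd; have [[_ _ _ _] [_ T_off]] := unslideP _ _ injF sF Qc rc.
have ic : i <= c.1 by case/and3P: Qc.
have upE r x : c.1.+1 < r -> goes_up T j r x = goes_up F j r x.
  move=> cr; rewrite /goes_up !T_off //; apply/or4P; apply: Or42.
    by move: cr; clear; lia.
  by move: cr; clear; lia.
have exitE r x : c.1.+1 < r -> exit_col T j r x = exit_col F j r x.
  by move=> cr; elim: x => //= x ->; rewrite upE.
have enterE k : k < d.1 - c.1 -> enter_col T j d (d.1 - k) = enter_col F j d (d.1 - k).
  elim: k => [|k IH] kd; first by rewrite subn0 !enter_col_start.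
  have rE : (d.1 - k.+1).+1 = d.1 - k by move: kd; clear; lia.
  have lt : d.1 - k.+1 < d.1 by move: kd; clear; lia.
  rewrite (enter_colS T j d _ lt) (enter_colS F j d _ lt) rE.
  by rewrite IH ?exitE //; move: kd; clear; lia.
have {}enterE : enter_col T j d c.1.+1 = enter_col F j d c.1.+1.
  have := enterE (d.1 - c.1.+1); rewrite subKn //; apply.
  by move: cd; clear; lia.
have /andP[je De] := enter_diagram T d c.1.+1 Qd cd.
rewrite /path_lt ltnNge (ltnW cd) /= (gtn_eqF cd) (enter_colS F j d) //.
rewrite -enterE -exit_col_unslide_below //.
move: ic; rewrite leq_eqVlt => /orP[/eqP E|ic].
  have aE : a c.1 = j by rewrite -E; exact/eqP.
  by rewrite /reaches aE E eqn_leq exit_col_ge ?andbT.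
by rewrite (reaches_unslide_row d c.1) // ?(ltnW cd) // (enter_colS T j d).
Qed.

End Unslid.

(** The number r_h from which the weight is built. *)
Definition reach_count (G : nat * nat -> nat) (h : nat) : nat :=
  count (fun d => [&& d.1 == h, quadrant d & reaches G j i d]) (cells lam).

Lemma count_row (h t : nat) : 0 < h -> (j < t -> D (h, t.-1)) ->
  count (fun d => (d.1 == h) && (j <= d.2 < t)) (cells lam) = t - j.
Proof.
move=> h0 Dt; rewrite -size_filter.
have <- : size [seq (h, x) | x <- iota j (t - j)] = t - j by rewrite size_map size_iota.
apply: perm_size; apply: uniq_perm.
- by rewrite filter_uniq // cells_uniq.
- by rewrite map_inj_uniq ?iota_uniq // => x y [].
case=> r x; rewrite mem_filter mem_cells /=; apply/idP/mapP => [|[y]].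
  case/andP=> /andP[/eqP-> jxt] _; exists x => //.
  by rewrite mem_iota; move: jxt; clear; lia.
rewrite mem_iota => jy [-> ->]; rewrite eqxx /=; apply/andP; split.
  by move: jy; clear; lia.
have jt : j < t by move: jy; clear; lia.
by apply: diagram_down (Dt jt) _ _; move: h0 j_gt0 jy; clear; lia.
Qed.

End Region.

Section Column.

Variables (j : nat) (L : nat).
Hypotheses (j_gt0 : 0 < j) (L_col : forall r, 0 < r -> D (r, j) = (r <= L)).

Definition weight (i : nat) (G : nat * nat -> nat) : nat :=
  \prod_(i <= h < L.+1) (L - h + reach_count i j G h).

Definition reaching (i : nat) (F : nat * nat -> nat) : seq (nat * nat) :=
  [seq d <- cells lam | quadrant i j d && reaches F j i d].

Lemma quadrantS i d : quadrant i.+1 j d = quadrant i j d && (i < d.1).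
Proof. by rewrite /quadrant; case: (D d) => //=; clear; lia. Qed.

(** [prod_telescope] is applied with N h = L - h to the reaching cells, ordered by their walks. The
    summand of c is then matched factor by factor with the weight of the filling undone from c. *)
Lemma weight_recurrence i F : 0 < i <= L -> {in D &, injective F} -> sorted_on i j F ->
  weight i F = \sum_(c <- reaching i F) weight i.+1 (unslide i j F c).
Proof.
move=> /andP[i0 iL] injF sF.
have rowL d : quadrant i j d -> d.1 <= L.
  case: d => r x /and3P[Dd /= ir jx]; rewrite -L_col ?(leq_trans i0 ir) //.
  by apply: diagram_down Dd _ _; move: i0 j_gt0 ir jx; clear; lia.
have cntE P h : count (fun d => (d.1 == h) && P d) (reaching i F) =
    count (fun d => [&& d.1 == h, quadrant i j d, reaches F j i d & P d]) (cells lam).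
  rewrite count_filter; apply: eq_count => d /=.
  by case: (d.1 == h); case: (P d); rewrite ?andbT ?andbF.
have -> : weight i F = \prod_(i <= h < L.+1)
    (L - h + count (fun d => d.1 == h) (reaching i F)).
  apply: eq_bigr => h _; congr (_ + _).
  have /= := cntE predT h; rewrite /reach_count.
  under eq_count do rewrite andbT; move=> ->.
  by apply: eq_count => d; rewrite andbT.
rewrite (@prod_telescope _ _ (path_lt F j)) //; first last.
- move=> d; rewrite mem_filter => /andP[/andP[Qd _] _]; have := rowL d Qd.
  by case/and3P: Qd => _ -> _; rewrite ltnS.
- by move=> x y _ _; exact: path_lt_total.
- exact: path_lt_trans.
- exact: path_lt_irr.
- by rewrite filter_uniq // cells_uniq.
(* The product of the numbers L - h vanishes because of its factor h = L. *)
rewrite [X in X + _](_ : _ = 0) ?add0n; last first.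
  by rewrite big_nat_recr //= subnn muln0.
rewrite big_seq [RHS]big_seq; apply: eq_bigr => c.
rewrite mem_filter => /andP[/andP[Qc rc] _].
have cL := rowL c Qc; have /and3P[Dc ic jc] := Qc.
(* Both products are split at row c.1. Above it, row h on the left corresponds to row h + 1 on the
   right; below it, rows correspond to themselves. *)
rewrite /weight (@big_cat_nat _ _ _ c.1) ?(leqW cL) //=.
rewrite (@big_cat_nat _ _ _ c.1.+1 i.+1) //=.
rewrite [X in _ * X = _]big_ltn_cond // eqxx /= [X in _ = X * _]big_add1 /=.
congr (_ * _).
  rewrite [LHS]big_nat_cond [RHS]big_nat_cond; apply: eq_big => h.
    by rewrite !andbT; case: (ltngtP h c.1) => //=; rewrite ?andbF ?andbT.
  case/andP=> /andP[ih hc] _.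
  have [jb Db] : j <= enter_col F j c h /\ D (h.+1, enter_col F j c h).
    have /andP[ja _] := on_path_ge i j F c Qc h.+1.
    have := on_path_diagram i j i0 j_gt0 F c Qc h.+1 (enter_col F j c h).
    rewrite (enter_colS F j c h hc) => H; split=> //; apply: H.
      by rewrite (leqW ih) hc.
    by rewrite ja exit_col_le.
  have h0 := leq_trans i0 ih.
  have -> : count (fun d => (d.1 == h) && path_lt F j d c) (reaching i F) =
      enter_col F j c h - j.
    rewrite cntE -(count_row j j_gt0 h) //; last first.
      by move=> jlt; apply: diagram_down Db _ _; move: h0 j_gt0 jlt; clear; lia.
    apply: eq_in_count => d; rewrite mem_cells => Dd.
    case: eqP => //= Ed; have lt : path_lt F j d c = (d.2 < enter_col F j c h).
      by rewrite /path_lt Ed hc.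
    rewrite lt {1}/quadrant Dd Ed ih /=; case: (leqP j d.2) => //= jd.
    case: ltnP => db; last by rewrite andbF.
    rewrite (path_lt_reaches i j F c d Qc _ rc) ?lt //.
    by rewrite /quadrant Dd Ed ih.
  (* One cell more than in row h before undoing, which compensates L - (h + 1) against L - h. *)
  have -> : reach_count i.+1 j (unslide i j F c) h.+1 = (enter_col F j c h).+1 - j.
    rewrite /reach_count -(count_row j j_gt0 h.+1) //; apply: eq_in_count => d.
    rewrite mem_cells => Dd; case: eqP => //= Ed.
    rewrite {1}/quadrant Dd Ed ltnS ih /=; case: (leqP j d.2) => //= jd.
    have Qd : quadrant i j d by rewrite /quadrant Dd Ed (leqW ih).
    by rewrite (reaches_unslide_above i j) ?Ed //= ltnS ih.
  by move: (leq_trans hc cL) jb; clear; lia.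
rewrite [LHS]big_nat_cond [RHS]big_nat_cond; apply: eq_big => h.
  by rewrite !andbT; case: (ltngtP h c.1) => //=; rewrite ?andbF ?andbT.
case/andP=> /andP[ch hL] _; congr (_ + _); rewrite cntE.
apply: eq_in_count => d; rewrite mem_cells => Dd; case: eqP => //= Ed.
rewrite quadrantS; case Qd : (quadrant i j d) => //=.
rewrite Ed (leq_ltn_trans ic ch) (reaches_unslide_below i j) ?Ed //=.
case lt : (path_lt F j d c); rewrite ?andbF // andbT.
by rewrite (path_lt_reaches i j F c d Qc Qd rc lt).
Qed.

End Column.

(** * Columns of the diagram and the sorting order *)

(** The part of the conjugate partition with index j. *)
Definition col_len (j : nat) : nat := find (fun p => p < j) lam.

Lemma col_lenP j r : 0 < j -> 0 < r -> D (r, j) = (r <= col_len j).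
Proof.
move=> j0 r0; rewrite /in_diagram /= r0 j0 /=; apply/idP/idP => [jl|rl].
  rewrite leqNgt; apply/negP => lt.
  have le : col_len j <= r.-1 by move: lt; clear; lia.
  have := leq_trans jl (nth_part_anti _ _ le).
  rewrite /col_len; case: (boolP (has (fun p => p < j) lam)) => [hs|nh].
    by have := nth_find 0 hs; clear; lia.
  by rewrite hasNfind // nth_default // leqNgt j0.
have lt : r.-1 < col_len j by move: rl r0; clear; lia.
by have := before_find 0 lt; rewrite ltnNge => /negbFE.
Qed.

Definition column_from (i j : nat) : seq (nat * nat) :=
  [seq (r, j) | r <- iota i ((col_len j).+1 - i)].

(** A final segment of the sorting order. For i = [col_len j] + 1 it begins with the next column. *)
Definition cells_from (i j : nat) : seq (nat * nat) :=
  column_from i j ++ flatten [seq column_from 1 k | k <- iota j.+1 (head 0 lam - j)].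

Lemma cells_from_cons i j : i <= col_len j ->
  cells_from i j = (i, j) :: cells_from i.+1 j.
Proof.
move=> iL; rewrite /cells_from /column_from.
by have -> : (col_len j).+1 - i = ((col_len j).+1 - i.+1).+1 by move: iL; clear; lia.
Qed.

Lemma cells_from1 :
  cells_from 1 1 = flatten [seq column_from 1 k | k <- iota 1 (head 0 lam)].
Proof.
rewrite /cells_from; case E: (head 0 lam) => [|m] /=; last by rewrite subn1.
have : (1 <= col_len 1) = false by rewrite -col_lenP // /in_diagram /= nth0 E.
by rewrite /column_from; case: (col_len 1).
Qed.

Lemma cells_fromE : cells lam = cells_from 1 1.
Proof.
have colE j : 0 < j ->
    [seq c <- [seq (i, j) | i <- iota 1 (size lam)] | D c] = column_from 1 j.
  move=> j0; rewrite filter_map /column_from subn1 /=; congr map.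
  rewrite (@eq_in_filter _ _ (fun r => r <= col_len j)); last first.
    by move=> r; rewrite mem_iota /= => /andP[r0 _]; exact: col_lenP.
  have le : col_len j <= size lam by exact: find_size.
  rewrite -(subnKC le) iotaD filter_cat.
  rewrite (@eq_in_filter _ _ predT (iota 1 _)); last first.
    by move=> r; rewrite mem_iota; clear; move=> /=; lia.
  rewrite (@eq_in_filter _ _ pred0 (iota _ (_ - _))); last first.
    by move=> r; rewrite mem_iota; clear; move=> /=; lia.
  by rewrite filter_predT filter_pred0 cats0.
have flatE s : all (fun j => 0 < j) s ->
    [seq c <- [seq (i, j) | j <- s, i <- iota 1 (size lam)] | D c] =
    flatten [seq column_from 1 k | k <- s].
  elim: s => //= j s IH /andP[j0 s0].
  by rewrite filter_cat colE // IH.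
rewrite /cells flatE; last by apply/allP => j; rewrite mem_iota => /andP[].
by rewrite cells_from1.
Qed.

(** * Uniformity of the sorting algorithm *)

(** The value 0 outside the diagram is the default of [fill], so such functions correspond exactly
    to the lists in [tabloids]. *)
Definition is_tabloid (F : nat * nat -> nat) : Prop :=
  perm_eq (map F (cells lam)) (iota 1 (sumn lam)) /\ forall c, ~~ D c -> F c = 0.

(** Double counting of the pairs formed by a column and a part that meets it. *)
Lemma size_cells : size (cells lam) = sumn lam.
Proof.
have colE j : 0 < j -> col_len j = count (fun p => j <= p) lam.
  move=> j0; have le : col_len j <= size lam by exact: find_size.
  rewrite -[in RHS](cat_take_drop (col_len j) lam) count_cat.
  have /eqP -> : count (fun p => j <= p) (take (col_len j) lam) == size (take (col_len j) lam).
    rewrite -all_count; apply/(all_nthP 0) => k; rewrite size_takel // => kl.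
    have := col_lenP j k.+1 j0 isT; rewrite kl nth_take //.
    by rewrite /in_diagram j0 /=.
  have /eqP -> : count (fun p => j <= p) (drop (col_len j) lam) == 0.
    rewrite -leqn0 leqNgt -has_count; apply/(has_nthP 0) => -[k].
    rewrite size_drop nth_drop => ks.
    have := col_lenP j (col_len j + k).+1 j0 isT.
    rewrite ltnNge leq_addr /in_diagram j0 /=.
    by move=> ->.
  by rewrite size_takel // addn0.
have {}colE j : 0 < j -> size (column_from 1 j) = \sum_(p <- lam) (j <= p).
  move=> j0; rewrite size_map size_iota subn1 /= colE // -sum1_count big_mkcond.
  by apply: eq_bigr => p _; case: ifP.
rewrite cells_fromE cells_from1 [in RHS]sumnE.
rewrite size_flatten /shape -map_comp sumnE big_map.
rewrite (eq_big_seq (fun j => \sum_(p <- lam) (j <= p))); last first.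
  by move=> j; rewrite mem_iota => /andP[j0 _] /=; rewrite colE.
rewrite exchange_big /= [LHS]big_seq [RHS]big_seq; apply: eq_bigr => p pl.
have ph : p <= head 0 lam.
  rewrite -nth0 -(nth_index 0 pl); apply: nth_part_anti; exact: leq0n.
rewrite -(subnKC ph) iotaD big_cat /=.
rewrite [X in _ + X]big_seq [X in _ + X]big1 ?addn0; last first.
  by move=> j; rewrite mem_iota; clear; lia.
rewrite (eq_big_seq (fun=> 1)); first by rewrite sum1_size size_iota.
by move=> j; rewrite mem_iota; clear; lia.
Qed.

Lemma fill_map F : (forall c, ~~ D c -> F c = 0) -> fill lam (map F (cells lam)) = F.
Proof.
move=> F0; apply: functional_extensionality => c; rewrite /fill.
case Dc: (D c); last first.
  by rewrite F0 ?Dc // nth_default // size_map memNindex // mem_cells Dc.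
have cin : c \in cells lam by rewrite mem_cells.
by rewrite (nth_map (0, 0)) ?index_mem // nth_index.
Qed.

Lemma map_fill t : size t = sumn lam -> map (fill lam t) (cells lam) = t.
Proof.
move=> st; apply: (@eq_from_nth _ 0); rewrite size_map size_cells // => k kn.
rewrite (nth_map (0, 0)) ?size_cells // /fill index_uniq ?size_cells //.
exact: cells_uniq.
Qed.

Lemma size_tabloid t : t \in tabloids lam -> size t = sumn lam.
Proof. by rewrite mem_permutations => /perm_size ->; rewrite size_iota. Qed.

Lemma fill_tabloid t : t \in tabloids lam -> is_tabloid (fill lam t).
Proof.
move=> tt; split; first by rewrite map_fill ?size_tabloid // -mem_permutations.
move=> c Dc; rewrite /fill nth_default // memNindex ?mem_cells //.
by rewrite size_tabloid // size_cells.
Qed.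

Lemma tabloid_mem F : is_tabloid F -> map F (cells lam) \in tabloids lam.
Proof. by case=> pF _; rewrite mem_permutations. Qed.

Lemma tabloid_inj F : is_tabloid F -> {in D &, injective F}.
Proof.
case=> pF _ c d Dc Dd E.
have cin : c \in cells lam by rewrite mem_cells.
have din : d \in cells lam by rewrite mem_cells.
have uF : uniq (map F (cells lam)) by rewrite (perm_uniq pF) iota_uniq.
rewrite -(nth_index (0, 0) cin) -(nth_index (0, 0) din); congr nth.
apply/eqP; rewrite -(nth_uniq 0 _ _ uF) ?size_map ?index_mem //.
by rewrite !(nth_map (0, 0)) ?index_mem // !nth_index // E.
Qed.

Lemma tabloid_swap F p q : D p -> D q -> is_tabloid F -> is_tabloid (swapF F p q).
Proof.
move=> Dp Dq [pF F0]; split.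
  by apply: perm_trans pF; apply: perm_map_swapF; rewrite ?cells_uniq ?mem_cells.
move=> c Dc; rewrite swapFo ?F0 //; apply/eqP => E; move: Dc; rewrite E.
  by rewrite Dp.
by rewrite Dq.
Qed.

Lemma tabloid_eq F G : is_tabloid F -> is_tabloid G ->
  map F (cells lam) = map G (cells lam) -> F = G.
Proof.
by move=> [_ F0] [_ G0] E; rewrite -(fill_map F F0) E fill_map.
Qed.

Lemma tabloid_slide_aux fuel F p : D p -> is_tabloid F ->
  is_tabloid (slide_aux fuel lam F p).
Proof.
elim: fuel F p => // fuel IH F p Dp tF; rewrite slide_auxS.
have := small_childP F p; case: (small_child F p) => // q [/childP[Dq _] _].
by case: ifP => // _; apply: IH => //; apply: tabloid_swap.
Qed.

Lemma tabloid_slide F p : D p -> is_tabloid F -> is_tabloid (slide lam F p).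
Proof. exact: tabloid_slide_aux. Qed.

Lemma tabloid_unslide i j F c : 0 < i -> 0 < j -> is_tabloid F -> sorted_on i j F ->
  quadrant i j c -> reaches F j i c -> is_tabloid (unslide i j F c).
Proof.
move=> i0 j0 tF sF Qc rc; have [_ Qch] := reaches_chain i j i0 j0 F c Qc rc.
rewrite /unslide; move: (_ + _) Qch => m; elim: m => // m IH Qch.
have Qch' l : l <= m -> quadrant i j (chain j F c l).
  by move=> lm; apply: Qch; exact: leqW.
have injF := tabloid_inj F tF; have slF := sorted_sliding i j F c sF Qc.
have [[s2 _ _ _] _] := unslide_iter i j i0 j0 F c m injF slF Qch'.
have [[s2' _ _ _] _] := unslide_iter i j i0 j0 F c m.+1 injF slF Qch.
move: s2' (IH Qch'); rewrite iterS [_.2]/= => s2' tm.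
rewrite [_.1]/= s2'; apply: tabloid_swap => //; last by case/and3P: (Qch m.+1 (leqnn _)).
by rewrite s2; case/and3P: (Qch' m (leqnn _)).
Qed.

(** Because of [foldr] the last cell of s is treated first, as in the sorting algorithm. *)
Definition sort_cells (s : seq (nat * nat)) (F : nat * nat -> nat) : nat * nat -> nat :=
  foldr (fun c G => slide lam G c) F s.

Lemma tabloid_sort s F : all D s -> is_tabloid F -> is_tabloid (sort_cells s F).
Proof. by elim: s => //= c s IH /andP[Dc Ds] tF; apply: tabloid_slide => //; apply: IH. Qed.

Lemma cells_from_diagram i j : 0 < i -> 0 < j -> all D (cells_from i j).
Proof.
have col a b : 0 < a -> 0 < b -> all D (column_from a b).
  move=> a0 b0; apply/allP => c /mapP[r]; rewrite mem_iota => ra ->.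
  by rewrite col_lenP //; move: a0 ra; clear; lia.
move=> i0 j0; rewrite all_cat col //=; apply/allP => c /flattenP[s /mapP[k]].
by rewrite mem_iota => /andP[jk _] -> cs; apply: (allP (col 1 k isT _)) cs; apply: leq_ltn_trans jk.
Qed.
(** Neither predecessor of (i, j) lies in the region, so the last condition of [sliding] is void at
    the start. *)
Lemma sliding_start i j F : D (i, j) -> sliding i j F (i, j) <-> sorted_on i.+1 j F.
Proof.
move=> Dz; have regE c : region i j c -> c != (i, j) -> region i.+1 j c.
  by case: c => r x; rewrite /region xpair_eqE /= => /andP[->]; clear; lia.
split=> [[_ H _] c d Rc cd|sF].
  apply: H => //; move: Rc; case: (c) => r x; rewrite /region ?xpair_eqE /=.
    by case/andP=> ->; clear; lia.
  by case/andP=> _; clear; lia.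
split; first by rewrite /quadrant Dz /= !leqnn.
  by move=> c d Rc cd cz; apply: sF => //; apply: regE.
move=> u d Ru /childP[_ E]; move: Ru; case: u E => r x /= E.
by rewrite /region /=; case: E => -[-> ->] => /andP[_]; clear; lia.
Qed.

Lemma sorted_on_column j F : 0 < j ->
  sorted_on (col_len j).+1 j F <-> sorted_on 1 j.+1 F.
Proof.
move=> j0; have regE c : region (col_len j).+1 j c = region 1 j.+1 c.
  case: c => r x; rewrite /region /=; case Dc: (D (r, x)) => //=.
  case/andP: (diagram_pos _ _ Dc) => r0 x0.
  have : x = j -> r <= col_len j by move=> E; rewrite -col_lenP // -E.
  by move: r0; clear; lia.
by split=> sF c d Rc; apply: sF; rewrite ?regE // -regE.
Qed.

Lemma reaches_top j F c : 0 < j -> quadrant 1 j c -> reaches F j 1 c.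
Proof.
move=> j0 /and3P[_ _ jc]; rewrite /reaches eqn_leq exit_col_ge ?enter_col_ge // andbT.
by have := goes_up_exit F j 1 (enter_col F j c 1); rewrite /goes_up orbF.
Qed.

Lemma weight_top j L F G : 0 < j -> weight j L 1 F = weight j L 1 G.
Proof.
move=> j0; apply: eq_bigr => h _; congr (_ + _); apply: eq_count => d.
by case Qd: (quadrant 1 j d); rewrite ?andbF // !reaches_top.
Qed.

Definition fibre (s : seq (nat * nat)) (F : nat * nat -> nat) : nat :=
  count (fun t => map (sort_cells s (fill lam t)) (cells lam) == map F (cells lam))
        (tabloids lam).

(** The invariant carried backwards along the sorting order; K is the same for all fillings. *)
Definition stage (i j K : nat) : Prop :=
  {in tabloids lam, forall t, sorted_on i j (sort_cells (cells_from i j) (fill lam t))} /\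
  forall F, is_tabloid F -> sorted_on i j F ->
    fibre (cells_from i j) F = K * weight j (col_len j) i F.

Lemma count_sum (T : Type) (P : pred T) (s : seq T) :
  count P s = \sum_(x <- s) nat_of_bool (P x).
Proof. by elim: s => [|x s IH] /=; rewrite ?big_nil // big_cons IH. Qed.

(** The fibre of F is the disjoint union of the fibres of its undone fillings, one for each reaching
    cell; [weight_recurrence] adds up their sizes. *)
Lemma stage_cell i j K : 0 < j -> 0 < i <= col_len j -> stage i.+1 j K -> stage i j K.
Proof.
move=> j0 /andP[i0 iL] [srt fib].
have Dz : D (i, j) by rewrite col_lenP.
have cE := cells_from_cons i j iL.
have tabG t : t \in tabloids lam -> is_tabloid (sort_cells (cells_from i.+1 j) (fill lam t)).
  by move=> tt; apply: tabloid_sort (fill_tabloid t tt); exact: cells_from_diagram.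
have slG t : t \in tabloids lam ->
    sliding i j (sort_cells (cells_from i.+1 j) (fill lam t)) (i, j).
  by move=> tt; apply/(sliding_start _ _ _ Dz); exact: srt.
split=> [t tt|F tF sF].
  rewrite cE /=.
  by case: (slideP i j i0 j0 _ (tabloid_inj _ (tabG t tt)) (slG t tt)).
have injF := tabloid_inj F tF.
rewrite (weight_recurrence j _ j0 (fun r => col_lenP j r j0)) //; last by rewrite i0.
have inA c : c \in reaching j i F -> quadrant i j c /\ reaches F j i c.
  by rewrite mem_filter => /andP[/andP[]].
have tU c : c \in reaching j i F -> is_tabloid (unslide i j F c).
  by case/inA => Qc rc; apply: tabloid_unslide.
have -> : K * (\sum_(c <- reaching j i F) weight j (col_len j) i.+1 (unslide i j F c)) =
    \sum_(c <- reaching j i F) fibre (cells_from i.+1 j) (unslide i j F c).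
  rewrite big_distrr /= [LHS]big_seq [RHS]big_seq; apply: eq_bigr => c cA.
  have [Qc rc] := inA c cA; rewrite fib //; first exact: tU.
  have [[slU _ _ _] _] := unslideP i j i0 j0 F c injF sF Qc rc.
  exact: (iffLR (sliding_start _ _ _ Dz)).
rewrite /fibre count_sum cE.
under [RHS]eq_bigr do rewrite count_sum.
rewrite exchange_big /= [LHS]big_seq [RHS]big_seq; apply: eq_bigr => t tt.
have tG := tabG t tt; move: (slG t tt); set G := sort_cells _ _ in tG * => slG'.
have eqU c : c \in reaching j i F ->
    (map G (cells lam) == map (unslide i j F c) (cells lam)) -> G = unslide i j F c.
  by move=> cA /eqP; apply: tabloid_eq => //; apply: tU.
(* A tabloid whose slide gives F is counted for exactly one cell c, any other tabloid for none. *)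
have [/(tabloid_eq _ _ (tabloid_slide _ _ Dz tG) tF) E|ne] := eqVneq; last first.
  rewrite big_seq big1 // => c cA; have [Qc rc] := inA c cA.
  case: (boolP (_ == _)) => // /(eqU c cA) GE.
  have [[_ slE _ _] _] := unslideP i j i0 j0 F c injF sF Qc rc.
  by rewrite GE slE eqxx in ne.
have [_ [c0]] := slideP i j i0 j0 G (tabloid_inj _ tG) slG'.
rewrite E => -[Qc0 rc0 GE].
have c0A : c0 \in reaching j i F.
  by rewrite mem_filter Qc0 rc0 mem_cells; case/and3P: Qc0.
rewrite -count_sum (@eq_in_count _ _ (pred1 c0)).
  by rewrite count_uniq_mem ?c0A // filter_uniq ?cells_uniq.
(* The filling undone from c holds F c in (i, j), so it determines c. *)
move=> c cA /=; apply/idP/eqP => [/(eqU c cA) GE'|->]; last by rewrite GE.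
have [Qc rc] := inA c cA.
have [[_ _ Uc _] _] := unslideP i j i0 j0 F c injF sF Qc rc.
have [[_ _ Uc0 _] _] := unslideP i j i0 j0 F c0 injF sF Qc0 rc0.
apply: injF; [by case/and3P: Qc | by case/and3P: Qc0 |].
by rewrite -Uc -GE' -GE Uc0.
Qed.

Lemma stage_column j K : 0 < j -> stage (col_len j).+1 j K -> stage 1 j K.
Proof.
move=> j0 st; suff st_i k : k <= col_len j -> stage ((col_len j).+1 - k) j K.
  by have := st_i (col_len j) (leqnn _); rewrite subSnn.
elim: k => [|k IH] kL; first by rewrite subn0.
apply: stage_cell => //; first by move: kL; clear; lia.
have -> : ((col_len j).+1 - k.+1).+1 = (col_len j).+1 - k by move: kL; clear; lia.
by apply: IH; exact: ltnW.
Qed.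

(** Below the end of column j the weight is an empty product, and the weight at the top of the next
    column does not depend on the filling, so it can be absorbed into the constant. *)
Lemma stage_next_column j K : 0 < j <= head 0 lam -> stage 1 j.+1 K ->
  exists K', stage (col_len j).+1 j K'.
Proof.
move=> /andP[j0 jh] [srt fib].
have cE : cells_from (col_len j).+1 j = cells_from 1 j.+1 \/
    cells_from (col_len j).+1 j = [::] /\ j = head 0 lam.
  rewrite /cells_from /column_from subnn /= subn1 /=.
  case: (ltnP j (head 0 lam)) => jh'; last first.
    by right; split; [have -> : head 0 lam - j = 0 by lia | lia].
  left; have -> : head 0 lam - j = (head 0 lam - j.+1).+1 by move: jh'; clear; lia.
  by rewrite /= /column_from subn1.
have {}cE : cells_from (col_len j).+1 j = cells_from 1 j.+1.
  case: cE => // -[-> E]; rewrite /cells_from.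
  have -> : head 0 lam - j.+1 = 0 by move: E; clear; lia.
  have : (1 <= col_len j.+1) = false.
    by rewrite -col_lenP // /in_diagram /= nth0 -E ltnn.
  by rewrite /column_from; case: (col_len j.+1).
(* The zero filling is an arbitrary choice, justified by [weight_top]. *)
exists (K * weight j.+1 (col_len j.+1) 1 (fun=> 0)); split=> [t tt|F tF sF].
  by rewrite cE; apply/sorted_on_column => //; exact: srt.
rewrite cE fib //; last exact/sorted_on_column.
by rewrite (weight_top _ _ F (fun=> 0)) // /weight [X in _ = _ * X]big_geq ?muln1.
Qed.

(** Right of the last column nothing is sorted yet, and every filling has itself as its only
    preimage. *)
Lemma stage_start : stage 1 (head 0 lam).+1 1.
Proof.
have : (1 <= col_len (head 0 lam).+1) = false.
  by rewrite -col_lenP // /in_diagram /= nth0 ltnn.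
case E: (col_len (head 0 lam).+1) => // _.
have cE : cells_from 1 (head 0 lam).+1 = [::].
  by rewrite /cells_from /column_from E /=; have -> : head 0 lam - (head 0 lam).+1 = 0 by lia.
have srt F : sorted_on 1 (head 0 lam).+1 F.
  case=> r x d /andP[Dc Rc] _; have := nth_part_anti 0 r.-1 (leq0n _).
  move: Dc Rc; rewrite /in_diagram /= nth0; clear; lia.
split=> // F tF _; rewrite cE /weight E big_geq // /fibre /=.
rewrite (@eq_in_count _ _ (pred1 (map F (cells lam)))).
  by rewrite count_uniq_mem ?permutations_uniq // tabloid_mem.
by move=> t tt /=; rewrite map_fill // size_tabloid.
Qed.

Lemma stage_first j : 0 < j <= (head 0 lam).+1 -> exists K, stage 1 j K.
Proof.
move=> /andP[j0 jh].
suff H k : k <= head 0 lam -> exists K, stage 1 ((head 0 lam).+1 - k) K.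
  by have := H ((head 0 lam).+1 - j); rewrite subKn //; apply; move: j0; clear; lia.
elim: k => [|k IH] kh; first by exists 1; rewrite subn0; exact: stage_start.
have [K stK] := IH (ltnW kh).
have jE : (head 0 lam).+1 - k = ((head 0 lam).+1 - k.+1).+1 by move: kh; clear; lia.
rewrite jE in stK.
have [|K' stK'] := stage_next_column _ _ _ stK; first by move: kh; clear; lia.
by exists K'; apply: stage_column => //; move: kh; clear; lia.
Qed.

Lemma sort_uniform :
  {in tabloids lam, forall t, sorted_on 1 1 (sort_cells (cells lam) (fill lam t))} /\
  exists K, forall F, is_tabloid F -> sorted_on 1 1 F -> fibre (cells lam) F = K.
Proof.
have [K] := stage_first 1 isT; rewrite /stage -cells_fromE => -[srt fib].
split=> //; exists (K * weight 1 (col_len 1) 1 (fun=> 0)) => F tF sF.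
by rewrite fib // (weight_top _ _ F (fun=> 0)).
Qed.
(** * Exchanges *)

Lemma cells_from_suffix i j : 0 < i <= (col_len j).+1 -> 0 < j <= head 0 lam ->
  exists p, cells lam = p ++ cells_from i j.
Proof.
move=> /andP[i0 iL] /andP[j0 jh].
have rows : iota 1 (col_len j) = iota 1 i.-1 ++ iota i ((col_len j).+1 - i).
  have -> : col_len j = i.-1 + ((col_len j).+1 - i) by move: i0 iL; clear; lia.
  by rewrite iotaD add1n prednK //; congr (_ ++ iota _ _); move: i0 iL; clear; lia.
have cols : iota 1 (head 0 lam) = iota 1 j.-1 ++ j :: iota j.+1 (head 0 lam - j).
  have -> : head 0 lam = j.-1 + (head 0 lam - j).+1 by move: j0 jh; clear; lia.
  by rewrite iotaD add1n prednK //=; congr (_ ++ _ :: iota _ _); move: j0 jh; clear; lia.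
rewrite cells_fromE cells_from1 cols map_cat flatten_cat /=.
rewrite [column_from 1 j]/column_from subn1 /= rows map_cat -catA catA.
by eexists; rewrite /cells_from.
Qed.

Lemma drop_cells i j : D (i, j) ->
  drop (index (i, j) (cells lam)).+1 (cells lam) = cells_from i.+1 j.
Proof.
move=> Dz; case/andP: (diagram_pos _ _ Dz) => i0 j0.
have iL : i <= col_len j by rewrite -col_lenP.
have jh := diagram_head i j Dz.
have [p E] : exists p, cells lam = p ++ cells_from i j.
  by apply: cells_from_suffix; rewrite ?i0 ?j0 ?leqW.
have cE := cells_from_cons i j iL.
have := cells_uniq; rewrite E cE cat_uniq /= negb_or => /and3P[_ /andP[zp _] _].
by rewrite index_cat (negPf zp) /= eqxx addn0 drop_cat ltnNge leqnSn /= subSnn /= drop0.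
Qed.

(* Slides performed before that of (i, j) start at cells outside the rectangle
   spanned by (1, 1) and (i, j), hence leave the entry of (i, j) in place. *)
Definition beyond (z c : nat * nat) : bool := D c && ~~ ((c.1 <= z.1) && (c.2 <= z.2)).

Lemma drop_cells_beyond z : D z ->
  all (beyond z) (drop (index z (cells lam)).+1 (cells lam)).
Proof.
case: z => i j Dz; case/andP: (diagram_pos _ _ Dz) => i0 j0.
rewrite drop_cells //; apply/allP => c cin.
rewrite /beyond (allP (cells_from_diagram i.+1 j isT j0)) //=.
move: cin; rewrite mem_cat => /orP[/mapP[r]|/flattenP[s /mapP[k]]].
  by rewrite mem_iota => /andP[ir _] -> /=; move: ir; clear; lia.
rewrite mem_iota => /andP[jk _] -> /mapP[r _ ->] /=.
by move: jk; clear; lia.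
Qed.

Lemma stage_all i j : 0 < i <= (col_len j).+1 -> 0 < j <= head 0 lam ->
  exists K, stage i j K.
Proof.
move=> iL jh.
have [|K1 st1] := stage_first j.+1; first by move: jh; clear; lia.
have [K stK] := stage_next_column j K1 jh st1.
exists K; have [j0 _] := andP jh; have [i0 iL'] := andP iL.
rewrite -(subKn iL'); have : (col_len j).+1 - i <= col_len j by move: iL; clear; lia.
elim: ((col_len j).+1 - i) => [|k IH] kL; first by rewrite subn0.
apply: stage_cell => //; first by move: kL; clear; lia.
have -> : ((col_len j).+1 - k.+1).+1 = (col_len j).+1 - k by move: kL; clear; lia.
by apply: IH; exact: ltnW.
Qed.

Definition before (z : nat * nat) (F : nat * nat -> nat) : nat * nat -> nat :=
  sort_cells (drop (index z (cells lam)).+1 (cells lam)) F.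

Lemma tabloid_before z F : is_tabloid F -> is_tabloid (before z F).
Proof.
apply: tabloid_sort; apply/allP => c /mem_drop.
by rewrite mem_cells.
Qed.

Lemma sliding_before i j t : t \in tabloids lam -> D (i, j) ->
  sliding i j (before (i, j) (fill lam t)) (i, j).
Proof.
move=> tt Dz; case/andP: (diagram_pos _ _ Dz) => i0 j0.
apply/(sliding_start _ _ _ Dz); rewrite /before drop_cells //.
have iL : i <= col_len j by rewrite -col_lenP.
have jh := diagram_head i j Dz.
by have [|K [srt _]] := stage_all i.+1 j _ (introT andP (conj j0 jh)); [rewrite ltnS | exact: srt].
Qed.

Lemma slide_aux_off fuel F p c : ~~ ((p.1 <= c.1) && (p.2 <= c.2)) ->
  slide_aux fuel lam F p c = F c.
Proof.
elim: fuel F p => // fuel IH F p pc; rewrite slide_auxS.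
have := small_childP F p; case: (small_child F p) => // q [/childP[_ E] _].
case: ifP => // _.
have qc : ~~ ((q.1 <= c.1) && (q.2 <= c.2)).
  by move: pc; case: E => -> /=; clear; lia.
rewrite IH // swapFo //; apply/eqP => E2; [move: pc | move: qc].
  by rewrite E2 !leqnn.
by rewrite E2 !leqnn.
Qed.

Lemma sort_cells_off s F z : all (beyond z) s -> sort_cells s F z = F z.
Proof.
elim: s => //= c s IH /andP[/andP[_ cz] sz].
by rewrite /slide slide_aux_off // IH.
Qed.

Lemma slide_last_cell F c : (forall d, ~~ child c d) -> slide lam F c = F.
Proof.
move=> nc; rewrite /slide; case: (size _) => // k; rewrite slide_auxS.
have := small_childP F c; case: (small_child F c) => // q [cq _].
by rewrite (negPf (nc q)) in cq.
Qed.

(** [before] also slides at the last cell z_n, which [nps_before] omits. That cell has no right or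
    bottom neighbour, so its slide is the identity. *)
Lemma nps_beforeE F z : z \in cells lam -> nps_before lam F z = before z F.
Proof.
move=> zin; rewrite /nps_before /before /sort_cells.
have s0 : 0 < size (cells lam) by case: (cells lam) zin.
have [c nc E] : exists2 c, forall d, ~~ child c d & cells lam = rcons (take (size (cells lam)).-1 (cells lam)) c.
  have h0 : 0 < head 0 lam.
    case: z zin => i j; rewrite mem_cells => /andP[/andP[/= i0 j0] jl].
    by have := nth_part_anti 0 i.-1 (leq0n _); rewrite nth0; move: j0 jl; clear; lia.
  have L0 : 0 < col_len (head 0 lam).
    by rewrite -col_lenP // /in_diagram /= h0 nth0 leqnn.
  have [p E] : exists p, cells lam = p ++ cells_from (col_len (head 0 lam)) (head 0 lam).
    by apply: cells_from_suffix; rewrite ?L0 ?h0 ?leqnSn ?leqnn.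
  exists (col_len (head 0 lam), head 0 lam).
    move=> d; apply/negP => /childP[Dd [] Ed]; move: Dd; rewrite Ed /=.
      rewrite /in_diagram /= -nth0 => /andP[_].
      by rewrite ltnNge nth_part_anti.
    by rewrite col_lenP // ltnn.
  rewrite /cells_from subnn /= cats0 /column_from subSnn /= cats1 in E.
  by rewrite {1}E; congr rcons; rewrite E size_rcons /= -cats1 take_size_cat.
have -> : drop (index z (cells lam)).+1 (cells lam) =
   if (index z (cells lam)).+1 <= (size (cells lam)).-1
   then rcons (drop (index z (cells lam)).+1 (take (size (cells lam)).-1 (cells lam))) c
   else [::].
  case: ifP => [le|/negbT]; last first.
    by rewrite -ltnNge => lt; rewrite drop_oversize //; move: lt s0; clear; lia.
  rewrite {2}E drop_rcons // size_takel //; exact: leq_pred.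
case: ifP => [le|/negbT].
  by rewrite foldr_rcons slide_last_cell.
rewrite -ltnNge => lt; rewrite drop_oversize // size_takel; last exact: leq_pred.
by move: lt; clear; lia.
Qed.

(** * Cohooks of the entries during sorting *)

Lemma tabloid_range F c : is_tabloid F -> D c -> 0 < F c <= sumn lam.
Proof.
case=> pF _ Dc; have : F c \in iota 1 (sumn lam).
  by rewrite -(perm_mem pF) map_f // mem_cells.
by rewrite mem_iota add1n ltnS.
Qed.

Lemma tabloid_cell F l : is_tabloid F -> 0 < l <= sumn lam -> exists2 c, D c & F c = l.
Proof.
case=> pF _ ln; have : l \in map F (cells lam).
  by rewrite (perm_mem pF) mem_iota add1n ltnS.
by case/mapP => c; rewrite mem_cells => Dc ->; exists c.
Qed.

(** The cohook of the cell that holds k, as a sum over cells so that it can be interchanged with the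
    sum over tabloids. *)
Definition entry_cohook (k : nat) (F : nat * nat -> nat) : nat :=
  \sum_(x <- cells lam) cohook x * (F x == k).

Lemma entry_cohookE F c : is_tabloid F -> D c -> entry_cohook (F c) F = cohook c.
Proof.
move=> tF Dc; have cin : c \in cells lam by rewrite mem_cells.
rewrite /entry_cohook (bigD1_seq c) ?cells_uniq //= eqxx muln1 big_seq_cond big1 ?addn0 //.
move=> x /andP[]; rewrite mem_cells => Dx xc; case: eqP => [E|]; last by rewrite muln0.
by rewrite (tabloid_inj _ tF _ _ Dx Dc E) eqxx in xc.
Qed.

(** Once the moving entry has gone from p to q, the rest of the slide stays weakly south-east of q
    and cannot touch p again. Hence an entry is displaced at most once, by one cell. *)
Lemma slide_aux_entry fuel F p c : D p -> D c -> c != p ->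
  slide_aux fuel lam F p c = F c \/
  F c < F p /\ exists2 d, D d /\ child d c & slide_aux fuel lam F p d = F c.
Proof.
elim: fuel F p => [|fuel IH] F p Dp Dc cp; first by left.
rewrite slide_auxS; have := small_childP F p.
case: (small_child F p) => [q [pq _]|_]; last by left.
case: ifP => [lt|_]; last by left.
have Dq : D q by case/childP: pq.
have [E|cq] := eqVneq c q.
  right; rewrite E; split=> //; exists p => //; rewrite slide_aux_off ?swapFl //.
  by case/childP: pq => _ [] -> /=; clear; lia.
by have := IH (swapF F p q) q Dq Dc cq; rewrite swapFr swapFo.
Qed.

(** [slide_moves] may also hold for the moving entry itself; the condition k < F p leaves only the
    entries exchanged with it. *)
Definition displaced (F : nat * nat -> nat) (p : nat * nat) (k : nat) : bool :=
  (k < F p) && slide_moves lam F p k.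

Lemma slide_entry_cohook F p k : is_tabloid F -> D p -> 0 < k <= sumn lam -> k != F p ->
  entry_cohook k (slide lam F p) + displaced F p k = entry_cohook k F.
Proof.
move=> tF Dp kn kp; have tS := tabloid_slide F p Dp tF.
have [c Dc Ec] := tabloid_cell F k tF kn.
have cp : c != p by apply/eqP => E; rewrite -Ec E eqxx in kp.
have mvE : slide_moves lam F p k = (slide lam F p c != k).
  apply/hasP/idP => [[d]|ne]; last by exists c; rewrite ?mem_cells // Ec eqxx.
  rewrite mem_cells => Dd /andP[/eqP Ed].
  by rewrite (tabloid_inj F tF d c Dd Dc) // Ed.
rewrite -Ec entry_cohookE // /displaced Ec mvE -Ec.
have [E|[lt [d [Dd dc] E]]] := slide_aux_entry (size (cells lam)) F p c Dp Dc cp.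
  by rewrite -/(slide lam F p) in E; rewrite -{1 3}E entry_cohookE // E eqxx andbF addn0.
rewrite -/(slide lam F p) in E; rewrite lt -{1}E entry_cohookE //.
have -> : slide lam F p c != F c.
  rewrite -E; apply/eqP => /(tabloid_inj _ tS c d Dc Dd) cd.
  by have := child_neq _ _ dc; rewrite cd eqxx.
have := child_sum _ _ dc; case: (c) Dc => r x /diagram_pos.
case: (d) Dd => r' x' /diagram_pos; rewrite /cohook /=; clear; lia.
Qed.

Lemma sum_entry_cohook F : is_tabloid F ->
  \sum_(1 <= l < (sumn lam).+1) entry_cohook l F = \sum_(x <- cells lam) cohook x.
Proof.
move=> tF; rewrite /entry_cohook exchange_big /= [LHS]big_seq [RHS]big_seq.
apply: eq_bigr => x; rewrite mem_cells => Dx; rewrite -big_distrr /=.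
have /andP[F0 Fn] := tabloid_range F x tF Dx.
rewrite (bigD1_seq (F x)) ?iota_uniq ?mem_index_iota ?F0 ?ltnS //= eqxx.
by rewrite big1 ?addn0 ?muln1 // => l; rewrite eq_sym => /negPf ->.
Qed.

(* The moving entry gains the total cohook lost by the entries it displaces. *)
Lemma slide_entry_cohook_all F p k : is_tabloid F -> D p -> 0 < k <= sumn lam ->
  entry_cohook k (slide lam F p) + displaced F p k =
  entry_cohook k F + (F p == k) * \sum_(1 <= l < k) displaced F p l.
Proof.
move=> tF Dp kn; case: (eqVneq (F p) k) => [E|ne]; last first.
  by rewrite mul0n addn0 slide_entry_cohook // eq_sym.
have tS := tabloid_slide F p Dp tF.
have := sum_entry_cohook _ tS; rewrite -(sum_entry_cohook _ tF).
have kin : k \in index_iota 1 (sumn lam).+1 by rewrite mem_index_iota ltnS.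
rewrite (bigD1_seq k) ?iota_uniq //= [in RHS](bigD1_seq k) ?iota_uniq //=.
rewrite [X in _ = _ + X](_ : _ =
   \sum_(1 <= l < (sumn lam).+1 | l != k) entry_cohook l (slide lam F p) +
   \sum_(1 <= l < (sumn lam).+1 | l != k) displaced F p l); last first.
  rewrite -big_split /= big_seq_cond [RHS]big_seq_cond; apply: eq_bigr => l.
  rewrite mem_index_iota ltnS => /andP[ln lk].
  by rewrite slide_entry_cohook // E.
have -> : \sum_(1 <= l < (sumn lam).+1 | l != k) displaced F p l =
    \sum_(1 <= l < k) displaced F p l.
  have /andP[k0 kn'] := kn.
  rewrite (@big_cat_nat _ _ _ k) ?(leqW kn') //= [X in _ + X]big_nat_cond.
  rewrite [X in _ + X]big1 ?addn0; last first.
    by move=> l /andP[/andP[kl _] _]; rewrite /displaced E ltnNge kl.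
  rewrite big_nat_cond [RHS]big_nat_cond; apply: eq_bigl => l; rewrite andbT.
  by case: (ltngtP l k); rewrite ?andbF ?andbT.
by rewrite {2}/displaced E ltnn mul1n /=; clear; lia.
Qed.

Definition slide_at (t : seq nat) (m : nat) : nat -> bool :=
  displaced (before (nth (0, 0) (cells lam) m) (fill lam t)) (nth (0, 0) (cells lam) m).

(** Earlier slides leave the cell z untouched, so k is the moving entry exactly once, in the slide
    at its initial cell. The balances of the single slides are added up. *)
Lemma sort_entry_cohook t k : t \in tabloids lam -> 0 < k <= sumn lam ->
  entry_cohook k (sort_cells (cells lam) (fill lam t)) +
    \sum_(0 <= m < sumn lam) slide_at t m k =
  entry_cohook k (fill lam t) + \sum_(1 <= l < k) slide_at t (index k t) l.
Proof.
move=> tt kn; have tF := fill_tabloid t tt.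
have nthD m : m < sumn lam -> D (nth (0, 0) (cells lam) m).
  by move=> mn; rewrite -mem_cells mem_nth // size_cells.
have idx m : m < sumn lam -> index (nth (0, 0) (cells lam) m) (cells lam) = m.
  by move=> mn; rewrite index_uniq ?size_cells ?cells_uniq.
have step m : m <= sumn lam ->
    entry_cohook k (sort_cells (drop m (cells lam)) (fill lam t)) +
    \sum_(m <= m' < sumn lam) slide_at t m' k =
    entry_cohook k (fill lam t) +
    \sum_(m <= m' < sumn lam) (nth 0 t m' == k) * \sum_(1 <= l < k) slide_at t m' l.
  move=> mn; rewrite -(subKn mn); elim: (sumn lam - m) (leq_subr m (sumn lam)) => [|d IH] dn.
    by rewrite subn0 drop_oversize ?size_cells // !big_geq.
  have [lt E] : sumn lam - d.+1 < sumn lam /\ sumn lam - d = (sumn lam - d.+1).+1.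
    by move: dn; clear; lia.
  move: (IH (ltnW dn)); rewrite E; move: (sumn lam - d.+1) lt => m' lt {}IH.
  rewrite [in LHS]big_ltn // [in RHS]big_ltn // (drop_nth (0, 0)) ?size_cells //=.
  set z := nth (0, 0) (cells lam) m'.
  have Dz : D z by exact: nthD.
  have bE : sort_cells (drop m'.+1 (cells lam)) (fill lam t) = before z (fill lam t).
    by rewrite /before idx.
  have Ez : before z (fill lam t) z = nth 0 t m'.
    by rewrite /before sort_cells_off ?drop_cells_beyond // /fill idx.
  have := slide_entry_cohook_all _ z k (tabloid_before z _ tF) Dz kn.
  rewrite Ez; move: IH; rewrite bE /slide_at -/z.
  by clear; lia.
have := step 0 (leq0n _); rewrite drop0 => ->; congr (_ + _).
have kt : k \in t.
  by move: tt; rewrite mem_permutations => /perm_mem ->; rewrite mem_iota add1n ltnS.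
have ut : uniq t by move: tt; rewrite mem_permutations => /perm_uniq ->; rewrite iota_uniq.
have st := size_tabloid t tt.
have im : index k t < sumn lam by rewrite -st index_mem.
rewrite (bigD1_seq (index k t)) ?iota_uniq ?mem_index_iota //= nth_index // eqxx mul1n.
rewrite [X in _ + X]big_nat_cond [X in _ + X]big1 ?addn0 // => m /andP[/andP[_ mn] ne].
by case: eqP => // E; rewrite -E index_uniq ?eqxx ?st in ne.
Qed.

(* Exchange numbers with the entry l in the role of n. *)
Definition exch_by (l k : nat) : nat :=
  count (fun t => let z := nth (0, 0) (cells lam) (index l t) in
                  slide_moves lam (before z (fill lam t)) z k)
        (tabloids lam).

Lemma exch_byE k : 0 < sumn lam -> exch lam k = exch_by (sumn lam) k.
Proof.
move=> n0; apply: eq_in_count => t tt /=; rewrite nps_beforeE // mem_nth // size_cells.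
rewrite -[X in _ < X](size_tabloid t tt) index_mem.
by move: tt n0; rewrite mem_permutations => /perm_mem ->; rewrite mem_iota; clear; lia.
Qed.

(** The balance of [sort_entry_cohook] summed over all tabloids, with the slides indexed by their
    moving entry; only a moving entry l > k can displace k. *)
Lemma exch_balance k : 0 < k <= sumn lam ->
  \sum_(t <- tabloids lam) entry_cohook k (sort_cells (cells lam) (fill lam t)) +
    \sum_(k.+1 <= l < (sumn lam).+1) exch_by l k =
  \sum_(t <- tabloids lam) entry_cohook k (fill lam t) + \sum_(1 <= l < k) exch_by k l.
Proof.
move=> kn.
have exE l k' : exch_by l k' = _ := count_sum _ _ _.
rewrite [X in _ + X = _](eq_bigr _ (fun l _ => exE l k)).
rewrite [X in _ = _ + X](eq_bigr _ (fun l _ => exE k l)).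
rewrite [X in _ + X = _]exchange_big [X in _ = _ + X]exchange_big /= -!big_split /= [LHS]big_seq [RHS]big_seq.
apply: eq_bigr => t tt; have tF := fill_tabloid t tt.
have st := size_tabloid t tt.
have memt l : (l \in t) = (0 < l <= sumn lam).
  by move: tt; rewrite mem_permutations => /perm_mem ->; rewrite mem_iota add1n ltnS.
have ut : uniq t by move: tt; rewrite mem_permutations => /perm_uniq ->; rewrite iota_uniq.
have Ez m : m < sumn lam -> before (nth (0, 0) (cells lam) m) (fill lam t)
    (nth (0, 0) (cells lam) m) = nth 0 t m.
  move=> mn; rewrite /before sort_cells_off.
    by rewrite /fill index_uniq ?size_cells ?cells_uniq.
  by apply: drop_cells_beyond; rewrite -mem_cells mem_nth // size_cells.
have im l : l \in t -> index l t < sumn lam by rewrite -st index_mem.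
have := sort_entry_cohook t k tt kn.
have -> : \sum_(1 <= l < k) slide_at t (index k t) l =
   \sum_(1 <= l < k) slide_moves lam
      (before (nth (0, 0) (cells lam) (index k t)) (fill lam t))
      (nth (0, 0) (cells lam) (index k t)) l.
  rewrite big_nat_cond [RHS]big_nat_cond; apply: eq_bigr => l /andP[/andP[_ lk] _].
  have kt : k \in t by rewrite memt.
  by rewrite /slide_at /displaced Ez ?im // nth_index // lk.
move=> <-; congr (_ + _).
have reidx : \sum_(0 <= m < sumn lam) slide_at t m k =
    \sum_(1 <= l < (sumn lam).+1) slide_at t (index l t) k.
  have pt : perm_eq (index_iota 1 (sumn lam).+1) t.
    by rewrite perm_sym /index_iota subn1 -mem_permutations.
  rewrite (perm_big _ pt) /= -st.
  rewrite [RHS](big_nth 0) big_nat [RHS]big_nat; apply: eq_bigr => m mn.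
  by rewrite index_uniq.
rewrite reidx [in RHS](@big_cat_nat _ _ _ k.+1) //=; last first.
  by move: kn; clear; lia.
rewrite [X in _ = X + _]big_nat_cond [X in _ = X + _]big1 ?add0n.
  rewrite big_nat_cond [RHS]big_nat_cond; apply: eq_bigr => l /andP[/andP[kl ln] _].
  have lt : l \in t by rewrite memt; move: kl ln; clear; lia.
  by rewrite /slide_at /displaced Ez ?im // nth_index // kl.
move=> l /andP[/andP[l0 lk] _].
have lt : l \in t by rewrite memt; move: l0 lk kn; clear; lia.
by rewrite /slide_at /displaced Ez ?im // nth_index // ltnNge -ltnS lk.
Qed.

(** * Exchange numbers do not depend on the moving entry *)

(* The cyclic relabelling of {l, ..., n} that turns l into the largest entry. *)
Definition relabel (l v : nat) : nat :=
  if v == l then sumn lam else if l < v <= sumn lam then v.-1 else v.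

Lemma relabel_inj l : 0 < l <= sumn lam -> injective (relabel l).
Proof.
move=> ln u v; rewrite /relabel.
by case: (u =P l); case: (v =P l); do ?case: ifP; move: ln; clear; lia.
Qed.

Lemma relabel_range l v : 0 < l <= sumn lam -> 0 < v <= sumn lam ->
  0 < relabel l v <= sumn lam.
Proof. by rewrite /relabel; case: (v =P l); do ?case: ifP; clear; lia. Qed.

Lemma relabel_mono l u v : u <= sumn lam -> v <= sumn lam ->
  u != l -> v != l -> (relabel l u < relabel l v) = (u < v).
Proof.
rewrite /relabel => un vn ul vl; rewrite (negPf ul) (negPf vl).
by case: ifP; case: ifP; move: un vn ul vl; clear; lia.
Qed.

Lemma relabel_small l k v : l <= sumn lam -> k < l -> (relabel l v == k) = (v == k).
Proof. by rewrite /relabel => ln kl; case: (v =P l); do ?case: ifP; move: ln kl; clear; lia. Qed.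

Lemma perm_relabel l : 0 < l <= sumn lam ->
  perm_eq (map (map (relabel l)) (tabloids lam)) (tabloids lam).
Proof.
move=> ln; have inj := relabel_inj l ln.
have piota : perm_eq (map (relabel l) (iota 1 (sumn lam))) (iota 1 (sumn lam)).
  have uR : uniq (map (relabel l) (iota 1 (sumn lam))) by rewrite map_inj_uniq ?iota_uniq.
  have sub : {subset map (relabel l) (iota 1 (sumn lam)) <= iota 1 (sumn lam)}.
    move=> v /mapP[u]; rewrite !mem_iota !add1n !ltnS => un ->.
    exact: relabel_range.
  apply: uniq_perm; rewrite ?iota_uniq //.
  by have [] := uniq_min_size uR sub; rewrite ?size_map.
have uT : uniq (map (map (relabel l)) (tabloids lam)).
  by rewrite map_inj_uniq ?permutations_uniq //; exact: inj_map.
have sub : {subset map (map (relabel l)) (tabloids lam) <= tabloids lam}.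
  move=> s /mapP[t]; rewrite !mem_permutations => pt ->.
  exact: perm_trans (perm_map _ pt) piota.
apply: uniq_perm; rewrite ?permutations_uniq //.
by have [] := uniq_min_size uT sub; rewrite ?size_map.
Qed.

Lemma fill_relabel l t : 0 < l -> size t = sumn lam ->
  fill lam (map (relabel l) t) = relabel l \o fill lam t.
Proof.
move=> l0 st; apply: functional_extensionality => c; rewrite /fill /=.
case: (ltnP (index c (cells lam)) (size t)) => lt; first exact: nth_map.
rewrite !nth_default ?size_map // /relabel.
by case: eqP l0 => [<-|].
Qed.

Lemma swapF_comp (g : nat -> nat) F p q : swapF (g \o F) p q = g \o swapF F p q.
Proof.
by apply: functional_extensionality => c; rewrite /swapF /=; case: ifP => //; case: ifP.
Qed.

Lemma small_child_comp (g : nat -> nat) F p :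
  (forall c d, child p c -> child p d -> (g (F c) < g (F d)) = (F c < F d)) ->
  small_child (g \o F) p = small_child F p.
Proof.
move=> mono; rewrite /small_child.
case Dr: (D (p.1, p.2.+1)); case Db: (D (p.1.+1, p.2)) => //=.
by rewrite mono // /child ?Dr ?Db eqxx ?orbT.
Qed.

Definition within (p c : nat * nat) : bool := [&& D c, p.1 <= c.1 & p.2 <= c.2].

Lemma child_within p q : child p q -> within p q.
Proof. by case/childP => Dq E; rewrite /within Dq; case: E => -> /=; clear; lia. Qed.

Lemma within_trans p q c : within p q -> within q c -> within p c.
Proof. by case/and3P=> _ p1 p2 /and3P[Dc q1 q2]; rewrite /within Dc (leq_trans p1) ?(leq_trans p2). Qed.

(** A slide only compares entries weakly south-east of p, so it commutes with every g that respects
    their order. *)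
Lemma slide_aux_comp fuel (g : nat -> nat) F p : D p ->
  (forall c d, within p c -> within p d -> (g (F c) < g (F d)) = (F c < F d)) ->
  slide_aux fuel lam (g \o F) p = g \o slide_aux fuel lam F p.
Proof.
elim: fuel F p => // fuel IH F p Dp mono; rewrite !slide_auxS.
rewrite small_child_comp; last by move=> c d pc pd; apply: mono; exact: child_within.
have := small_childP F p; case: (small_child F p) => // q [pq _].
have wp : within p p by rewrite /within Dp !leqnn.
have wq := child_within _ _ pq; rewrite /= mono //.
case: ifP => // _; rewrite swapF_comp IH //; first by case/childP: pq.
have sw c : within q c -> within p (exchange_cells p q c).
  by move=> qc; apply: (exchange_cells_in (within p)) => //; apply: within_trans qc.
by move=> c d qc qd; rewrite !swapFE mono // sw.
Qed.

(** [relabel l] changes the order only in comparisons with l, and slides from cells beyond z never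
    meet l, which stays in z. *)
Lemma sort_cells_relabel s l F z : is_tabloid F -> D z -> F z = l ->
  all (beyond z) s -> sort_cells s (relabel l \o F) = relabel l \o sort_cells s F.
Proof.
move=> tF Dz Fz; elim: s => //= c s IH /andP[/andP[Dc cz] sz].
rewrite IH //; set G := sort_cells s F.
have tG : is_tabloid G.
  by apply: tabloid_sort tF; apply: sub_all sz => d /andP[].
have Gz : G z = l by rewrite /G sort_cells_off.
have ne d : within c d -> G d != l.
  move=> /and3P[Dd c1 c2]; apply/eqP => E.
  have dz : d = z by apply: (tabloid_inj G tG) => //; rewrite E.
  by move: cz; rewrite -dz c1 c2.
apply: slide_aux_comp => // d e cd ce; rewrite relabel_mono ?ne //.
  by case/and3P: cd => Dd _ _; case/andP: (tabloid_range G d tG Dd).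
by case/and3P: ce => De _ _; case/andP: (tabloid_range G e tG De).
Qed.

Lemma slide_aux_high fuel F p k c : D p -> (forall d, within p d -> k < F d) ->
  (slide_aux fuel lam F p c == k) = (F c == k).
Proof.
elim: fuel F p => // fuel IH F p Dp high; rewrite slide_auxS.
have := small_childP F p; case: (small_child F p) => // q [pq _].
case: ifP => // _; have wq := child_within _ _ pq.
have wp : within p p by rewrite /within Dp !leqnn.
have Dq : D q by case/childP: pq.
rewrite IH //; last first.
  move=> d qd; rewrite swapFE high //.
  by apply: (exchange_cells_in (within p)) => //; apply: within_trans qd.
have [->|cp] := eqVneq c p; first by rewrite swapFl !gtn_eqF ?high.
have [->|cq] := eqVneq c q; first by rewrite swapFr !gtn_eqF ?high.
by rewrite swapFo.
Qed.

Lemma sliding_within i j F p l : sliding i j F p ->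
  (forall d, child p d -> l < F d) -> forall d, within p d -> d != p -> l < F d.
Proof.
move=> [Qp H2 _] hi d; case/and3P: Qp => Dp ip jp.
have [m] := ubnP (d.1 + d.2); elim: m d => // m IH [r x] /= rx.
case/and3P=> Dd /= pr px ne; case/andP: (diagram_pos _ _ Dd) => r0 x0.
(* A predecessor of (r, x) that is still weakly south-east of p: the upper one if row r is below
   that of p, otherwise the left one. *)
have [e [De pe1 pe2 ed]] : exists e, [/\ D e, p.1 <= e.1, p.2 <= e.2 & child e (r, x)].
  case: (ltnP p.1 r) => pr'.
    exists (r.-1, x); split=> //=; last by rewrite /child Dd /= prednK ?eqxx ?orbT.
      case: (p) Dp pr' px => p1 p2 /diagram_pos /=; move=> pp pr' px.
      by apply: diagram_down Dd _ _; move: pp pr' px; clear; lia.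
    by move: pr'; clear; lia.
  have px' : p.2 < x.
    by move: ne; case: (p) pr px pr' => p1 p2 /=; rewrite xpair_eqE; clear; lia.
  exists (r, x.-1); split=> //=; last by rewrite /child Dd /= prednK ?eqxx.
    case: (p) Dp pr' px' => p1 p2 /diagram_pos /=; move=> pp pr'' px''.
    by apply: diagram_down Dd _ _; move: pp r0 px''; clear; lia.
  by move: px'; clear; lia.
have [E|nep] := eqVneq e p; first by apply: hi; rewrite -E.
have lt : l < F e.
  apply: IH => //; last by rewrite /within De pe1 pe2.
  by have := child_sum _ _ ed; move: rx; clear => /=; lia.
apply: ltn_trans lt _; apply: H2 => //; apply: quadrant_region.
by rewrite /quadrant De (leq_trans ip) ?(leq_trans jp).
Qed.

(* Once the entry l stops, the largest entry only displaces entries above l. *)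
Lemma slide_aux_relabel fuel i j F p l k c : 0 < i -> 0 < j ->
    is_tabloid F -> sliding i j F p -> F p = l -> k < l ->
  (slide_aux fuel lam (relabel l \o F) p c == k) = (slide_aux fuel lam F p c == k).
Proof.
move=> i0 j0; elim: fuel F p => [|fuel IH] F p tF slF Fp kl.
  by rewrite /= relabel_small // -Fp; case: slF => /and3P[Dp _ _] _ _; case/andP: (tabloid_range F p tF Dp).
have Dp : D p by case: slF => /and3P[].
have /andP[l0 ln] := tabloid_range F p tF Dp; rewrite Fp in l0 ln.
have ne d : D d -> d != p -> F d != l.
  move=> Dd; apply: contra => /eqP E; apply/eqP; apply: (tabloid_inj F tF) => //.
  by rewrite E.
have le_n d : D d -> F d <= sumn lam by move=> Dd; case/andP: (tabloid_range F d tF Dd).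
have chi d : child p d -> D d /\ d != p.
  by move=> pd; rewrite (child_neq _ _ pd); case/childP: pd.
have stop : (forall d, child p d -> l < F d) ->
    (slide_aux fuel.+1 lam (relabel l \o F) p c == k) = (F c == k).
  move=> hi; rewrite slide_aux_high //; first exact: relabel_small.
  move=> d pd; rewrite /= /relabel; case: eqP => [_|/eqP nl]; first exact: leq_trans kl ln.
  have Dd : D d by case/and3P: pd.
  have dp : d != p by apply/eqP => E; rewrite E Fp eqxx in nl.
  have lt := sliding_within i j F p l slF hi d pd dp.
  by rewrite lt (le_n d Dd) /=; move: lt kl; clear; lia.
have scE : small_child (relabel l \o F) p = small_child F p.
  apply: small_child_comp => d e /chi[Dd dp] /chi[De ep].
  by rewrite relabel_mono ?ne ?le_n.
have := small_childP F p; case E: (small_child F p) => [q|] => [[pq qmin]|none]; last first.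
  rewrite stop; first by rewrite slide_auxS E.
  by move=> d pd; rewrite (negPf (none d)) in pd.
have [Dq qp] := chi q pq.
case: (ltnP (F q) (F p)) => [lt|ge]; last first.
  rewrite stop; first by rewrite slide_auxS E ltnNge ge.
  move=> d pd; apply: leq_trans (qmin d pd).
  by rewrite ltn_neqAle -{2}Fp ge eq_sym ne.
rewrite !slide_auxS scE E lt /=.
have -> : relabel l (F q) < relabel l (F p).
  rewrite Fp in lt; rewrite Fp /relabel eqxx (negPf (ne q Dq qp)).
  by rewrite (ltnNge l) (ltnW lt) /= (leq_trans lt ln).
rewrite swapF_comp IH //; last by rewrite swapFr.
  exact: tabloid_swap.
by have [] := sliding_forward i j i0 j0 F p q (tabloid_inj F tF) slF pq lt qmin.
Qed.

(** [relabel l] permutes the tabloids and turns those with l in z into those with n in z. It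
    commutes with the slides before z, and by [slide_aux_relabel] the slide at z treats k in the
    same way. *)
Lemma exch_by_relabel l k : k < l <= sumn lam -> exch_by l k = exch_by (sumn lam) k.
Proof.
move=> /andP[kl ln]; have l0 : 0 < l <= sumn lam by rewrite ln andbT; move: kl; clear; lia.
have n0 : 0 < sumn lam by move: l0; clear; lia.
rewrite {2}/exch_by -(permP (perm_relabel l l0)) count_map.
apply: eq_in_count => t tt /=.
have st := size_tabloid t tt; have tF := fill_tabloid t tt.
have -> : index (sumn lam) (map (relabel l) t) = index l t.
  have {1}-> : sumn lam = relabel l l by rewrite /relabel eqxx.
  exact/index_map/relabel_inj.
have lt : l \in t.
  by move: tt; rewrite mem_permutations => /perm_mem ->; rewrite mem_iota; move: l0; clear; lia.
set z := nth _ _ _.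
have Dz : D z by rewrite -mem_cells mem_nth // size_cells -st index_mem.
have Fz : fill lam t z = l.
  by rewrite /fill index_uniq ?nth_index ?cells_uniq // size_cells -st index_mem.
rewrite fill_relabel //; last by case/andP: l0.
rewrite /before (sort_cells_relabel _ _ _ z) ?drop_cells_beyond // -/(before z (fill lam t)).
have slG : sliding z.1 z.2 (before z (fill lam t)) z.
  by case: (z) Dz => i j; exact: sliding_before.
have Gz : before z (fill lam t) z = l by rewrite /before sort_cells_off ?drop_cells_beyond.
have [z1 z2] : 0 < z.1 /\ 0 < z.2.
  by case: (z) Dz => r x /diagram_pos /andP[].
apply: eq_in_has => c _; congr (_ && _); first by rewrite relabel_small.
rewrite /slide (slide_aux_relabel _ z.1 z.2) //.
exact: tabloid_before.
Qed.

(** * Initial and final cohook sums, and the recurrence *)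

(** Relabelling shows that all n values occur equally often in c, and these numbers add up to n!. *)
Lemma count_entry c k : D c -> 0 < k <= sumn lam ->
  count (fun t => fill lam t c == k) (tabloids lam) = (sumn lam).-1`!.
Proof.
move=> Dc kn; have n0 : 0 < sumn lam by move: kn; clear; lia.
have same l : 0 < l <= sumn lam -> count (fun t => fill lam t c == l) (tabloids lam) =
    count (fun t => fill lam t c == sumn lam) (tabloids lam).
  move=> ln; rewrite -[in RHS](permP (perm_relabel l ln)) count_map.
  apply: eq_in_count => t tt /=; have l0 : 0 < l by case/andP: ln.
  rewrite fill_relabel ?size_tabloid //= -(inj_eq (relabel_inj l ln)).
  by rewrite [in LHS]/relabel eqxx.
have total : \sum_(1 <= l < (sumn lam).+1) count (fun t => fill lam t c == l) (tabloids lam) =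
    (sumn lam)`!.
  under eq_bigr do rewrite count_sum.
  rewrite exchange_big /= big_seq (eq_bigr (fun=> 1)).
    by rewrite -big_seq sum1_size size_permutations ?iota_uniq // size_iota.
  move=> t tt; have /andP[F0 Fn] := tabloid_range _ c (fill_tabloid t tt) Dc.
  rewrite (bigD1_seq (fill lam t c)) ?iota_uniq ?mem_index_iota ?F0 ?ltnS //= eqxx.
  by rewrite big1 // => l; rewrite eq_sym => /negPf ->.
have := total; rewrite big_nat (eq_bigr (fun=> count (fun t => fill lam t c == k) (tabloids lam))).
  rewrite -big_nat sum_nat_const_nat subn1 /= -{2}(prednK n0) factS prednK //.
  by move/eqP; rewrite eqn_pmul2l // => /eqP.
by move=> l; rewrite ltnS => ln; rewrite (same l) // (same k).
Qed.

Lemma standardP F : standard lam F <-> sorted_on 1 1 F.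
Proof.
have regE c : region 1 1 c = D c.
  by case: c => r x; rewrite /region; case Dc: (D _) => //=; have := diagram_pos _ _ Dc; clear => /=; lia.
split=> [/allP st c d|sF].
  rewrite regE => Dc cd; have := st c; rewrite mem_cells => /(_ Dc) /andP[/implyP r /implyP b].
  by case/childP: cd => Dd [] E; rewrite E in Dd *; [apply: r | apply: b].
apply/allP => c; rewrite mem_cells => Dc.
by apply/andP; split; apply/implyP => Dd; apply: sF; rewrite ?regE // /child Dd eqxx ?orbT.
Qed.

(** K is the common fibre size of the standard tableaux. Counting all tabloids by their outcome
    gives n! = K f, and counting those whose outcome has k in x gives the final cohook sum. *)
Lemma sorted_fibre : exists K,
  (sumn lam)`! = K * f_lam lam /\
  forall k, \sum_(t <- tabloids lam) entry_cohook k (sort_cells (cells lam) (fill lam t)) =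
            K * \sum_(x <- cells lam) cohook x * f_lam_at lam k x.
Proof.
have [srt [K fib]] := sort_uniform; exists K.
have Dcells : all D (cells lam) by apply/allP => c; rewrite mem_cells.
pose S t := map (sort_cells (cells lam) (fill lam t)) (cells lam).
have tS t : t \in tabloids lam -> is_tabloid (sort_cells (cells lam) (fill lam t)).
  by move=> tt; apply: tabloid_sort (fill_tabloid t tt).
have St t : t \in tabloids lam -> S t \in tabloids lam by move=> tt; apply/tabloid_mem/tS.
have fS t : t \in tabloids lam -> fill lam (S t) = sort_cells (cells lam) (fill lam t).
  by move=> tt; rewrite /S fill_map //; case: (tS t tt).
have stS t : t \in tabloids lam -> standard lam (fill lam (S t)).
  by move=> tt; rewrite fS //; apply/standardP/srt.
have countE (P : pred (seq nat)) : count (fun t => P (S t)) (tabloids lam) =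
    K * count (fun s => standard lam (fill lam s) && P s) (tabloids lam).
  rewrite count_sum big_seq (eq_bigr (fun t =>
    \sum_(s <- tabloids lam | standard lam (fill lam s) && P s) (S t == s))); last first.
    move=> t tt; case PS: (P (S t)); last first.
      rewrite big1 // => s /andP[_ Ps]; case: eqP => // E.
      by rewrite -E PS in Ps.
    rewrite big_mkcond /= (bigD1_seq (S t)) ?permutations_uniq ?St //= stS // PS eqxx.
    by rewrite big1 // => s; rewrite eq_sym => /negPf ->; case: ifP.
  rewrite -big_seq exchange_big /= -sum1_count big_distrr /= big_seq_cond [RHS]big_seq_cond.
  apply: eq_bigr => s /andP[ss /andP[sst _]].
  rewrite muln1 -(fib (fill lam s)); last 2 first.
  - exact: fill_tabloid.
  - exact/standardP.
  by rewrite /fibre map_fill ?size_tabloid // count_sum.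
split.
  have := countE predT; rewrite count_predT size_permutations ?iota_uniq // size_iota => ->.
  by congr (_ * _); apply: eq_count => s; rewrite andbT.
move=> k; rewrite big_distrr /= exchange_big /=; apply: eq_bigr => x _.
rewrite -big_distrr /= mulnCA -count_sum; congr (_ * _).
have := countE (fun s => fill lam s x == k); rewrite -/(f_lam_at lam k x) => <-.
by apply: eq_in_count => t tt; rewrite fS.
Qed.

(** The first formula in the natural numbers: subtracted terms change sides, and K stands for
    n!/f. *)
Lemma exch_recurrence k : 0 < k < sumn lam -> exists K,
  (sumn lam)`! = K * f_lam lam /\
  (sumn lam - k) * exch lam k + K * (\sum_(x <- cells lam) cohook x * f_lam_at lam k x) =
  (sumn lam).-1`! * (\sum_(x <- cells lam) cohook x) + \sum_(1 <= l < k) exch lam l.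
Proof.
move=> /andP[k0 kn]; have [K [fact fin]] := sorted_fibre; exists K; split=> //.
have n0 : 0 < sumn lam by move: k0 kn; clear; lia.
have := exch_balance k; rewrite fin k0 (ltnW kn) => /(_ isT).
have -> : \sum_(k.+1 <= l < (sumn lam).+1) exch_by l k = (sumn lam - k) * exch lam k.
  rewrite big_nat (eq_bigr (fun=> exch lam k)).
    by rewrite -big_nat sum_nat_const_nat subSS.
  by move=> l ln; rewrite exch_by_relabel -?exch_byE.
have -> : \sum_(t <- tabloids lam) entry_cohook k (fill lam t) =
    (sumn lam).-1`! * \sum_(x <- cells lam) cohook x.
  rewrite exchange_big /= big_distrr /= big_seq [RHS]big_seq; apply: eq_bigr => x.
  rewrite mem_cells => Dx; rewrite -big_distrr -count_sum /= count_entry //; first exact: mulnC.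
  by rewrite k0 (ltnW kn).
have -> : \sum_(1 <= l < k) exch_by k l = \sum_(1 <= l < k) exch lam l.
  rewrite big_nat [RHS]big_nat; apply: eq_bigr => l /andP[_ lk].
  by rewrite exch_by_relabel -?exch_byE // lk (ltnW kn).
by rewrite addnC.
Qed.

End Diagram.

(** * Solving the recurrence over the rationals *)

Local Open Scope ring_scope.

(* The recurrence telescopes: (n - l) (e_1 + ... + e_l) = l A - (B_1 + ... + B_l). *)
Lemma solve_recurrence (n k : nat) (e B : nat -> rat) (A : rat) : (1 <= k < n)%N ->
  (forall l, (1 <= l <= k)%N ->
     (n - l)%:R * e l = A + \sum_(1 <= m < l) e m - B l) ->
  (n - k)%:R * (n - k + 1)%:R * e k =
    n%:R * A - (n - k + 1)%:R * B k - \sum_(1 <= l < k) B l.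
Proof.
move=> /andP[k0 kn] rec.
have sumE l : (l < k)%N -> (n - l)%:R * \sum_(1 <= m < l.+1) e m =
    l%:R * A - \sum_(1 <= m < l.+1) B m.
  elim: l => [|l IH] lk; first by rewrite !big_geq // mulr0 mul0r subr0.
  have := IH (ltnW lk); have := rec l.+1; rewrite (ltnW lk) => /(_ isT).
  rewrite !(@big_nat_recr _ _ _ l.+1) //=.
  have -> : (n - l = (n - l.+1).+1)%N by lia.
  rewrite -!natr1; move: (\sum_(1 <= m < l.+1) e m) (\sum_(1 <= m < l.+1) B m) => s b.
  by move=> H2 H1; rewrite mulrDr H2; move: H1; rewrite mulrDl mul1r => H1; lra.
(* The sum of e_1, ..., e_(k-1) carries the factor n - (k - 1) = n - k + 1, the second factor of the
   denominator. *)
have := sumE k.-1; rewrite prednK // leqnn => /(_ isT).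
have -> : (n - k.-1 = n - k + 1)%N by lia.
have := rec k; rewrite k0 leqnn => /(_ isT) recE sE.
rewrite mulrAC recE mulrDl mulrDl mulrC [_ * (n - k + 1)%:R]mulrC.
have nE : n%:R = (n - k + 1)%:R + k.-1%:R :> rat by rewrite -natrD; congr _%:R; lia.
by rewrite [_ * (n - k + 1)%:R]mulrC sE nE; ring.
Qed.

Theorem theorem4 (n k : nat) (lam : seq nat) :
  is_partition lam -> sumn lam = n -> (1 <= k < n)%N ->
  ((n - k)%:R * (exch lam k)%:R =
     (n.-1)`!%:R * (\sum_(x <- cells lam) cohook x)%:R
     + (\sum_(1 <= l < k) exch lam l)%:R
     - n`!%:R / (f_lam lam)%:R
       * (\sum_(x <- cells lam) cohook x * f_lam_at lam k x)%:R :> rat)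
  /\
  ((exch lam k)%:R =
     n`!%:R / ((n - k) * (n - k + 1))%:R
     * \sum_(x <- cells lam) (cohook x)%:R
         * (1 - (f_lam_at lam k x)%:R / (f_lam lam)%:R * (n - k + 1)%:R
              - \sum_(1 <= l < k) (f_lam_at lam l x)%:R / (f_lam lam)%:R)
     :> rat).
Proof.
(* Division by f is legitimate because n! = K f is positive. *)
move=> lamP En kn; have f0 : (f_lam lam)%:R != 0 :> rat.
  have [|K [fact _]] := exch_recurrence lam lamP k; first by rewrite En.
  rewrite pnatr_eq0; apply/eqP => f0.
  by have := fact_gt0 (sumn lam); rewrite fact f0 muln0.
pose B l : rat := n`!%:R / (f_lam lam)%:R * (\sum_(x <- cells lam) cohook x * f_lam_at lam l x)%:R.
have rec l : (1 <= l < n)%N -> (n - l)%:R * (exch lam l)%:R =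
    (n.-1)`!%:R * (\sum_(x <- cells lam) cohook x)%:R +
    (\sum_(1 <= m < l) exch lam m)%:R - B l.
  move=> ln; have [|K [fact E]] := exch_recurrence lam lamP l; first by rewrite En.
  rewrite En in fact E; apply/eqP; rewrite /B -subr_eq opprK fact natrM mulfK //.
  by rewrite -!natrM -!natrD E.
split; first exact: rec.
have n0 : (0 < n)%N by lia.
have rec_k l : (1 <= l <= k)%N -> (n - l)%:R * (exch lam l)%:R =
    (n.-1)`!%:R * (\sum_(x <- cells lam) cohook x)%:R +
    \sum_(1 <= m < l) (exch lam m)%:R - B l.
  by move=> lk; rewrite -natr_sum rec //; clear -lk kn; lia.
have E := solve_recurrence n k (fun l => (exch lam l)%:R) B _ kn rec_k.
have nz : ((n - k) * (n - k + 1))%:R != 0 :> rat by rewrite pnatr_eq0 muln_eq0; clear -kn; lia.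
have factE : n`! = (n * n.-1`!)%N by rewrite -{1}(prednK n0) factS prednK.
apply: (mulfI nz); rewrite [in LHS]natrM E.
rewrite [in RHS]mulrA [X in _ = X * _]mulrC divfK //.
rewrite [n%:R * _]mulrA -natrM -factE.
(* The contribution of cell x to B l, up to the factor n!; it allows the sums over l and x to be
   interchanged. *)
pose g x l : rat := (cohook x)%:R * (f_lam_at lam l x)%:R / (f_lam lam)%:R.
have BE l : B l = n`!%:R * \sum_(x <- cells lam) g x l.
  rewrite /B natr_sum -mulrA mulr_sumr; congr (_ * _); apply: eq_bigr => x _.
  by rewrite natrM /g mulrC.
rewrite natr_sum BE (eq_bigr _ (fun l _ => BE l)) -mulr_sumr exchange_big /=.
rewrite mulrCA -!mulrBr; congr (_ * _).
rewrite mulr_sumr -!sumrB; apply: eq_bigr => x _.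
rewrite !mulrBr mulr1 mulr_sumr; congr (_ - _ - _).
  by rewrite /g; ring.
by apply: eq_bigr => l _; rewrite /g mulrA.
Qed.
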